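(* Every classical knot $K$ can be represented on a virtual row mosaic (a $1\times n$ virtual rectangular mosaic for some $n$) whose closure surface has genus zero.
   Context: Mosaic tiles are the eleven standard unit-square tiles $T_0,\dots,T_{10}$ ($T_0$ blank; $T_1,\dots,T_8$ non-crossing tiles with one or two arcs; $T_9,T_{10}$ the two crossing tiles, each containing a horizontal and a vertical strand crossing at the center). A virtual rectangular mosaic is an $m\times n$ array of tiles together with a pairing (with orientation) of the $2(m+n)$ boundary unit edges such that the quotient is a closed orientable surface $\Sigma_D$ carrying a knot diagram $D$; its genus is the genus of $\Sigma_D$ (for $m\times n$ with $v_D$ vertex classes after identification, $g(D)=(1-v_D+m+n)/2$). A genus zero mosaic thus gives a diagram on the sphere, i.e. a classical knot diagram. A row mosaic is a $1\times n$ virtual rectangular mosaic. *)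

(* Defs.v *)
From mathcomp Require Import all_boot.
From Stdlib Require Relations.Relation_Operators.
Set Implicit Arguments. Unset Strict Implicit. Unset Printing Implicit Defensive.

(* Knot diagrams on oriented surfaces, as combinatorial maps (PD codes).    *)
(* A diagram has nc crossings; crossing c has four slots 0,1,2,3 in         *)
(* counterclockwise order; slots i and i+2 lie on the same strand; the even *)
(* slots are on the under strand, the odd slots on the over strand.  A dart *)
(* is a (crossing, slot) pair; lnk pairs the two ends of every edge.        *)
(* nc = 0 encodes the crossingless diagram (a single circle).               *)

Definition sh (i : 'I_4) (k : nat) : 'I_4 := inord ((i + k) %% 4).

Record pd := PD { nc : nat; lnk : {ffun 'I_nc * 'I_4 -> 'I_nc * 'I_4} }.

Notation dart D := ('I_(nc D) * 'I_4)%type.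

Definition straight (D : pd) (d : dart D) : dart D := (d.1, sh d.2 2).
Definition rot (D : pd) (d : dart D) : dart D := (d.1, sh d.2 1).

Definition norbits (T : finType) (f : T -> T) : nat :=
  #|[set [set y | fconnect f x y] | x : T]|.

Definition pd_valid (D : pd) : Prop :=
  forall d : dart D, lnk D (lnk D d) = d /\ lnk D d <> d.

(* single component: the strand-following permutation has exactly two
   orbits (the two traversal directions of the unique component) *)
Definition pd_components2 (D : pd) : nat :=
  norbits (fun d : dart D => straight (lnk D d)).

Definition pd_faces (D : pd) : nat := norbits (fun d : dart D => rot (lnk D d)).

(* a knot diagram on the 2-sphere: Euler characteristic V - E + F = 2 with
   V = nc, E = 2 nc (the diagram is connected, being one component) *)
Definition sphere_knot (D : pd) : Prop :=
  nc D = 0 \/ [/\ pd_valid D, pd_components2 D = 2 & pd_faces D = nc D + 2].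

Definition pairing (T : eqType) (a b : T) (e : T) : option T :=
  if e == a then Some b else if e == b then Some a else None.

(* D is obtained from D' by deleting the crossings T of a tangle of D' and
   reconnecting: an edge of D' entering a tangle end e is continued through
   the tangle strand to the paired end thr e and onwards. *)
Definition contract_ok (D D' : pd) (T : {set 'I_(nc D')})
    (thr : dart D' -> option (dart D')) : Prop :=
  exists f : 'I_(nc D) -> 'I_(nc D'),
    [/\ injective f, forall c, f c \notin T,
        forall c', c' \notin T -> exists c, f c = c' &
        forall d : dart D,
          iter 4 (fun e => if thr e is Some e' then lnk D' e' else e)
               (lnk D' (f d.1, d.2))
          = (f (lnk D d).1, (lnk D d).2)].

Arguments contract_ok : clear implicits.

Definition R1 (D D' : pd) : Prop :=
  exists (c : 'I_(nc D')) (j : 'I_4),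
    lnk D' (c, j) = (c, sh j 1) /\
    contract_ok D D' [set c] (pairing (c, sh j 2) (c, sh j 3)).

(* R2: D' = D with a bigon added, one strand passing over the other twice *)
Definition R2 (D D' : pd) : Prop :=
  exists (c1 c2 : 'I_(nc D')) (p q : 'I_4),
    [/\ c1 != c2, odd p = odd q,
        lnk D' (c1, p) = (c2, q), lnk D' (c1, sh p 1) = (c2, sh q 3) &
        contract_ok D D' [set c1; c2]
          (fun e => if pairing (c1, sh p 2) (c2, sh q 2) e is Some x then Some x
                    else pairing (c1, sh p 3) (c2, sh q 1) e)].

Definition triangle (D : pd) (c1 c2 c3 : 'I_(nc D)) (a1 a2 a3 : 'I_4) : Prop :=
  [/\ [/\ c1 != c2, c2 != c3 & c1 != c3],
      lnk D (c1, a1) = (c2, sh a2 3), lnk D (c2, a2) = (c3, sh a3 3) &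
      lnk D (c3, a3) = (c1, sh a1 3)].

(* R3: the strand of the triangle joining c1 and c2 is over (or under) at
   both its crossings and is slid across the crossing c3 of the two other
   strands; the six tangle ends and all crossing informations are kept. *)
Definition R3 (D D' : pd) : Prop :=
  exists (c1 c2 c3 : 'I_(nc D)) (a1 a2 a3 : 'I_4)
         (e1 e2 e3 : 'I_(nc D')) (b1 b2 b3 : 'I_4)
         (f : 'I_(nc D) -> 'I_(nc D')),
    let endsD := [:: (c1, sh a1 1); (c1, sh a1 2); (c2, sh a2 1);
                     (c2, sh a2 2); (c3, sh a3 1); (c3, sh a3 2)] in
    let endsD' := [:: (e3, sh b3 2); (e2, sh b2 1); (e1, sh b1 2);
                      (e3, sh b3 1); (e2, sh b2 2); (e1, sh b1 1)] in
    let Phi (d : dart D) : dart D' :=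
      if d \in endsD then nth (f d.1, d.2) endsD' (index d endsD)
      else (f d.1, d.2) in
    [/\ triangle c1 c2 c3 a1 a2 a3, triangle e1 e2 e3 b1 b2 b3,
        odd a1 = odd (sh a2 3),
        [/\ odd b1 = odd a1, odd b2 = odd a2 & odd b3 = odd a3] &
        [/\ bijective f,
          forall c, (c \in [set c1; c2; c3]) = (f c \in [set e1; e2; e3]) &
          forall d : dart D, (d.1 \notin [set c1; c2; c3]) || (d \in endsD) ->
            lnk D' (Phi d) = Phi (lnk D d)]].

(* isomorphism of diagrams (orientation-preserving homeomorphism of the
   surface); a crossing may be relabelled by the half-turn i |-> i + 2 *)
Definition pd_iso (D D' : pd) : Prop :=
  exists (f : 'I_(nc D) -> 'I_(nc D')) (s : 'I_(nc D) -> bool),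
    bijective f /\
    forall d : dart D,
      lnk D' (f d.1, sh d.2 (2 * s d.1))
      = (f (lnk D d).1, sh (lnk D d).2 (2 * s (lnk D d).1)).

Definition rstep (D D' : pd) : Prop :=
  sphere_knot D /\ sphere_knot D' /\ [\/ pd_iso D D', R1 D D', R2 D D' | R3 D D'].

(* equivalence of classical knots = Reidemeister equivalence of sphere
   diagrams (Reidemeister's theorem) *)
Definition knot_equiv : pd -> pd -> Prop := Relation_Operators.clos_refl_sym_trans pd rstep.

(* Mosaic tiles.  Sides of a unit square: 0 = E, 1 = N, 2 = W, 3 = S        *)
(* (counterclockwise).  conn t s = the side joined to side s by a strand of *)
(* tile t.                                                                  *)
(*  T0 blank; T1 W-S; T2 S-E; T3 E-N; T4 N-W; T5 W-E; T6 N-S;               *)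
(*  T7 W-N and S-E; T8 W-S and N-E;                                         *)
(*  T9 crossing, vertical strand over; T10 crossing, horizontal strand over.*)

Definition tile := 'I_11.

Definition conn_nat (t s : nat) : option nat :=
  match t, s with
  | 1, 2 => Some 3 | 1, 3 => Some 2
  | 2, 3 => Some 0 | 2, 0 => Some 3
  | 3, 0 => Some 1 | 3, 1 => Some 0
  | 4, 1 => Some 2 | 4, 2 => Some 1
  | 5, 2 => Some 0 | 5, 0 => Some 2
  | 6, 1 => Some 3 | 6, 3 => Some 1
  | 7, 2 => Some 1 | 7, 1 => Some 2 | 7, 3 => Some 0 | 7, 0 => Some 3
  | 8, 2 => Some 3 | 8, 3 => Some 2 | 8, 1 => Some 0 | 8, 0 => Some 1
  | 9, 0 => Some 2 | 9, 2 => Some 0 | 9, 1 => Some 3 | 9, 3 => Some 1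
  | 10, 0 => Some 2 | 10, 2 => Some 0 | 10, 1 => Some 3 | 10, 3 => Some 1
  | _, _ => None
  end.

Definition conn (t : tile) (s : 'I_4) : option 'I_4 := omap (@inord 3) (conn_nat t s).
Definition active (t : tile) (s : 'I_4) : bool := conn t s != None.
Definition is_cross (t : tile) : bool := (t == 9 :> nat) || (t == 10 :> nat).

Definition slot_side (t : tile) (i : 'I_4) : 'I_4 :=
  if t == 10 :> nat then sh i 1 else i.

(* Virtual rectangular mosaics.  Tile (i, j) is in row i (row 0 on top) and *)
(* column j.  A port (i, j, s) is side s of tile (i, j); boundary ports are *)
(* the 2(m+n) boundary unit edges.  bpair is the pairing of boundary edges; *)
(* since the quotient of the rectangle (a single polygon) is orientable,    *)
(* each pair is glued reversing the counterclockwise boundary orientation. *)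

Record vmosaic (m n : nat) := VM {
  mtile : {ffun 'I_m * 'I_n -> tile};
  bpair : {ffun 'I_m * 'I_n * 'I_4 -> 'I_m * 'I_n * 'I_4} }.

Notation port m n := ('I_m * 'I_n * 'I_4)%type.

Definition is_bd m n (p : port m n) : bool :=
  let: (i, j, s) := p in
  [|| (s == 3 :> nat) && (i == m.-1 :> nat), (s == 0 :> nat) && (j == n.-1 :> nat),
      (s == 1 :> nat) && (i == 0 :> nat) | (s == 2 :> nat) && (j == 0 :> nat)].

Definition nb m n (p : port m n) : port m n :=
  let: (i, j, s) := p in
  match val s with
  | 0 => (i, insubd j j.+1, inord 2)
  | 1 => (insubd i i.-1, j, inord 3)
  | 2 => (i, insubd j j.-1, inord 0)
  | _ => (insubd i i.+1, j, inord 1)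
  end.

Definition adj m n (M : vmosaic m n) (p : port m n) : port m n :=
  if is_bd p then bpair M p else nb p.

Definition valid_vmosaic m n (M : vmosaic m n) : Prop :=
  [/\ 0 < m, 0 < n,
      (forall p : port m n, is_bd p ->
         [/\ is_bd (bpair M p), bpair M (bpair M p) = p & bpair M p != p]) &
      forall p : port m n,
        active (mtile M p.1) p.2 = active (mtile M (adj M p).1) (adj M p).2].

(* grid points (r, c), 0 <= r <= m, 0 <= c <= n; start and end of a
   boundary edge for the counterclockwise orientation of the boundary *)
Notation gpt m n := ('I_m.+1 * 'I_n.+1)%type.

Definition bstart m n (p : port m n) : gpt m n :=
  let: (i, j, s) := p in
  match val s with
  | 3 => (inord m, inord j)
  | 0 => (inord i.+1, inord n)
  | 1 => (inord 0, inord j.+1)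
  | _ => (inord i, inord 0)
  end.

Definition bend m n (p : port m n) : gpt m n :=
  let: (i, j, s) := p in
  match val s with
  | 3 => (inord m, inord j.+1)
  | 0 => (inord i, inord n)
  | 1 => (inord 0, inord j)
  | _ => (inord i.+1, inord 0)
  end.

Definition vrel m n (M : vmosaic m n) : rel (gpt m n) := fun x y =>
  [exists p : port m n, is_bd p &&
     (((bstart p == x) && (bend (bpair M p) == y)) ||
      ((bend p == x) && (bstart (bpair M p) == y)))].

Definition bpoint m n (x : gpt m n) : bool :=
  [|| x.1 == 0 :> nat, x.1 == m :> nat, x.2 == 0 :> nat | x.2 == n :> nat].

Definition nvert m n (M : vmosaic m n) : nat :=
  #|[set [set y | connect (vrel M) x y] | x : gpt m n & bpoint x]|.

Definition mgenus m n (M : vmosaic m n) : nat := (1 + m + n - nvert M)./2.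

Definition mrel m n (M : vmosaic m n) : rel (port m n) := fun p q =>
  active (mtile M p.1) p.2 &&
  (((p.1 == q.1) && (conn (mtile M p.1) p.2 == Some q.2)) || (adj M p == q)).

Definition knot_mosaic m n (M : vmosaic m n) : bool :=
  [exists p : port m n, active (mtile M p.1) p.2] &&
  [forall p : port m n, forall q : port m n,
     active (mtile M p.1) p.2 ==> active (mtile M q.1) q.2 ==> connect (mrel M) p q].

Definition mtrace m n (M : vmosaic m n) (p : port m n) : port m n :=
  iter (m * n * 4)
    (fun q : port m n => if is_cross (mtile M q.1) then q
                         else adj M (q.1, odflt q.2 (conn (mtile M q.1) q.2)))
    (adj M p).

Definition mosaic_pd m n (M : vmosaic m n) (D : pd) : Prop :=
  exists e : 'I_(nc D) -> 'I_m * 'I_n,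
    [/\ injective e, forall c, is_cross (mtile M (e c)),
        forall x, is_cross (mtile M x) -> exists c, e c = x &
        forall d : dart D,
          mtrace M (e d.1, slot_side (mtile M (e d.1)) d.2)
          = (e (lnk D d).1, slot_side (mtile M (e (lnk D d).1)) (lnk D d).2)].

(* Main.v *)
Require Import Defs.
From mathcomp Require Import all_boot all_fingroup zify.
From Stdlib Require Import Relations.Relation_Operators.
Set Implicit Arguments. Unset Strict Implicit. Unset Printing Implicit Defensive.

(* Only the tiles T7, T8 (two bends) and T9, T10 (crossings) occur in the row
   built here, so that a strand crosses every side of every tile.  A row of such
   tiles is a disc; read counterclockwise from its left end, its boundary carries
   a linear word of strand ends, one of which, the focus, is the right end.
   Appending T7 or T8 glued to one neighbour of the focus moves the focus along
   the word; glued to both neighbours it also cancels the focus against one of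
   them; appending a crossing replaces the focus by three new ends.  Placing the
   crossings along a spanning tree of the diagram leaves a word in which, by
   Euler's formula, the edges form a noncrossing matching, hence can be cancelled
   one after the other.  All gluings join adjacent ends, so the surface is a
   sphere.  T9 and T10 reach only two of the four positions of a crossing; the
   other two are obtained after a half turn of its labels. *)

(** * Permutations and their orbits *)

(** The obstacle is that a row grows at one end only, while the next crossing to place or the next
    pair to cancel may sit anywhere on the boundary; hence the moves of the focus. The argument is
    split at the relation [reach], a game on words: the invariant [tour] shows that the game can be
    won, and [row] turns each move into a tile. In [tour], planarity is carried by the inequality
    [tour_card]. It is an equality for a single crossing of a sphere diagram, and its right-hand
    side never changes: merging a crossing creates one face and uses up one unvisited crossing,
    while cancelling an edge trades one orbit for another. The single component supplies
    connectedness twice, for reaching all crossings and for the final mosaic. For the genus a lower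
    bound on the number of vertex classes suffices, so each partial row carries a labelling of its
    lattice points that respects the gluings. *)

Lemma val_sh (i : 'I_4) k : sh i k = (i + k) %% 4 :> nat.
Proof. by rewrite /sh inordK // ltn_pmod. Qed.

Lemma sh_sh (i : 'I_4) k l : sh (sh i k) l = sh i (k + l).
Proof. by apply: val_inj; rewrite /= !val_sh modnDml addnA. Qed.

Lemma sh4 (i : 'I_4) : sh i 4 = i.
Proof. by apply: val_inj; rewrite /= val_sh modnDr modn_small. Qed.

Lemma sh_inj k : injective (sh^~ k).
Proof.
move=> i j /(congr1 val); rewrite /= !val_sh => /eqP h; apply: val_inj => /=.
move: h; rewrite eqn_modDr => /eqP; by rewrite !modn_small.
Qed.

Lemma sh_neq (i : 'I_4) k : 0 < k < 4 -> sh i k != i.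
Proof.
move=> hk; apply/eqP => /(congr1 val); rewrite /= val_sh.
have := ltn_ord i; lia.
Qed.

Lemma norbits_perm (T : finType) (f : T -> T) (s : {perm T}) :
  f =1 s -> norbits f = #|porbits s|.
Proof.
move=> fs; rewrite /norbits; congr #|pred_of_set _|.
apply: eq_imset => x; apply/setP => y; rewrite inE.
apply/idP/porbitP => [/iter_findex <-|[i ->]].
  by exists (findex f x y); rewrite permX (eq_iter fs).
by rewrite permX -(eq_iter fs) fconnect_iter.
Qed.

Lemma norbits_conj (T U : finType) (f : T -> T) (g : U -> U) (h : T -> U) :
  bijective h -> (forall x, h (f x) = g (h x)) -> norbits f = norbits g.
Proof.
move=> [h' hK h'K] hfg; have hinj := can_inj hK.
have iterh i x : h (iter i f x) = iter i g (h x).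
  by elim: i => //= i <-.
have conn x y : fconnect g (h x) (h y) = fconnect f x y.
  apply/idP/idP => /iter_findex; last by move=> <-; rewrite iterh fconnect_iter.
  by rewrite -iterh => /hinj <-; apply: fconnect_iter.
rewrite /norbits -[LHS](card_imset _ (imset_inj hinj)); congr #|pred_of_set _|.
apply/setP => S; apply/imsetP/imsetP.
  move=> [_ /imsetP[x _ ->] ->]; exists (h x) => //.
  apply/setP => y; rewrite inE -[y]h'K conn mem_imset // inE //.
move=> [y _ ->]; exists [set z | fconnect f (h' y) z]; first exact: imset_f.
by apply/setP => z; rewrite inE -[z]h'K mem_imset // inE -conn !h'K.
Qed.

Lemma card_porbits_split (T : finType) (s : {perm T}) x y :
  x != y -> x \in porbit s y -> #|porbits (tperm x y * s)| = #|porbits s|.+1.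
Proof.
by move=> nxy h; have /= := porbits_mul_tperm s x y; rewrite h nxy addn0 addn1.
Qed.

Lemma card_porbits_join (T : finType) (s : {perm T}) x y :
  x \notin porbit s y -> #|porbits s| = #|porbits (tperm x y * s)|.+1.
Proof.
move=> h; have /= := porbits_mul_tperm s x y; rewrite h.
have -> : x != y by apply: contraNneq h => ->; apply: porbit_id.
by rewrite -muln2; lia.
Qed.

Lemma porbit_fix (T : finType) (s : {perm T}) x : s x = x -> porbit s x = [set x].
Proof.
move=> sx; apply/setP => y; rewrite inE; apply/porbitP/eqP => [[i ->]|->].
  by rewrite permX; elim: i => //= i ->.
by exists 0; rewrite expg0 perm1.
Qed.

(** An orbit other than a fixed point has at least two elements, so twice the number of orbits is at
    most [#|T|] plus the number of fixed points. *)
Lemma two_fixpoints (T : finType) (s : {perm T}) :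
  #|T| < (#|porbits s|).*2.-1 -> 
  exists x y, [/\ x != y, s x = x & s y = y].
Proof.
move=> hc; pose F := [set x | s x == x].
have cF : 1 < #|F|.
  have cov : \sum_(A in porbits s) #|A| = #|T|.
    have tp : trivIset (porbits s).
      apply/trivIsetP => _ _ /imsetP[x _ ->] /imsetP[y _ ->].
      apply: contraR; rewrite -setI_eq0 => /set0Pn[z /setIP[]].
      by rewrite -!eq_porbit_mem => /eqP <- /eqP <-.
    have := tp; rewrite /trivIset => /eqP ->.
    rewrite -cardsT; congr #|pred_of_set _|; apply/setP => x; rewrite inE.
    by apply/bigcupP; exists (porbit s x); rewrite ?porbit_id ?imset_f.
  have h : forall A, A \in porbits s -> 2 <= #|A| + (A \in set1 @: F).
    move=> _ /imsetP[x _ ->]; have := card_porbit_neq0 s x.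
    case: (boolP (s x == x)) => [/eqP sx|sx] c0.
      have -> : porbit s x \in set1 @: F.
        by rewrite (porbit_fix sx) imset_f // inE sx.
      lia.
    have : #|[set x; s x]| <= #|porbit s x|.
      apply/subset_leq_card/subsetP => y /set2P[]->; first exact: porbit_id.
      by rewrite -[s]expg1 mem_porbit.
    by rewrite cards2 eq_sym sx; lia.
  have h2 : \sum_(A in porbits s) 2 <=
            \sum_(A in porbits s) (#|A| + (A \in set1 @: F)) by apply: leq_sum.
  have h3 : \sum_(A in porbits s) (A \in set1 @: F : nat) <= #|F|.
    apply: leq_trans (leq_imset_card set1 F).
    rewrite -big_mkcondr sum1_card.
    by apply/subset_leq_card/subsetP => A /andP[].
  rewrite big_split /= cov sum_nat_const in h2.
  have aux t p f a : t < p.*2.-1 -> p * 2 <= t + a -> a <= f -> 1 < f by lia.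
  exact: aux hc h2 h3.
have /card_gt1P[x [y [xF yF nxy]]] := cF.
by exists x, y; move: xF yF; rewrite !inE => /eqP ? /eqP ?.
Qed.

(** * Boundary words of partial discs *)

Lemma eq_fpath_belast (T : eqType) (f g : T -> T) x s :
  {in belast x s, f =1 g} -> fpath f x s = fpath g x s.
Proof.
elim: s x => //= y s IH x fg; rewrite fg ?mem_head // IH // => z zs.
by apply: fg; rewrite inE zs orbT.
Qed.

(* [L] is the boundary word of a disc containing the crossings of [V], and [sg]
   is the rotation of the map in which this disc is contracted to one vertex.
   The two darts of an edge inside the disc are fixed by [sg] and form an orbit
   of [al * sg], so that [tour_card] is Euler's formula. *)
Record tour n (al rt sg : {perm 'I_n * 'I_4}) (L : seq ('I_n * 'I_4))
    (V : {set 'I_n}) : Prop := Tour {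
  tour_uniq : uniq L;
  tour_cycle : fcycle sg L;
  tour_visited : forall x, x \in L -> x.1 \in V;
  tour_closed : forall x, x.1 \in V -> x \notin L ->
    (al x \notin L) && ((al x).1 \in V);
  tour_fixed : forall x, x.1 \in V -> x \notin L -> sg x = x;
  tour_unvisited : forall x, x.1 \notin V -> sg x = rt x;
  tour_card : (2 * n).+1 <= #|porbits (al * sg)%g| + #|~: V| }.

Lemma mul_tperm_l (T : finType) (al sg : {perm T}) x y :
  (forall z, al (al z) = z) ->
  (al * (tperm x y * sg) = tperm (al x) (al y) * (al * sg))%g.
Proof.
move=> al2; rewrite !mulgA; congr (_ * sg)%g; apply/permP => z.
by rewrite !permM (inj_tperm _ _ _ perm_inj) !al2.
Qed.

(** The loop formed by [x] and [al x] is swallowed by the disc. The monogon it bounds disappears as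
    a face, but [{x, al x}] becomes an orbit of its own, so the orbit count is unchanged. *)
Lemma tour_cap n (al rt sg : {perm 'I_n * 'I_4}) a x b V :
  (forall z, al (al z) = z) -> a ++ b != [::] ->
  tour al rt sg (a ++ x :: al x :: b) V ->
  exists sg', tour al rt sg' (a ++ b) V.
Proof.
move=> al2 nab [uL cL vL clL fL outL card].
set x' := al x in uL cL vL clL fL *.
have memL z : (z \in a ++ x :: x' :: b) = [|| z == x, z == x' | z \in a ++ b].
  by rewrite !mem_cat !inE; do !case: (_ \in _); do !case: (_ == _).
have [ux ux' uab nxx'] : [/\ x \notin a ++ b, x' \notin a ++ b, uniq (a ++ b) & x != x'].
  have : uniq (x :: x' :: (b ++ a)) by have := uL; rewrite uniq_catC.
  rewrite /= inE negb_or uniq_catC !(mem_cat _ b a) (orbC (_ \in b)) (orbC (_ \in b)).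
  by rewrite -!mem_cat => /andP[/andP[-> ->] /andP[-> ->]].
have {cL} : fcycle sg (x :: x' :: (b ++ a)).
  by have := cL; rewrite cycle_catC.
(* [p] is the cyclic predecessor of [x], which exists because [a ++ b] is nonempty; it is the only
   remaining letter whose successor changes. *)
have [r [p [mr ur cyc Eba]]] : exists r p, [/\ rcons r p =i a ++ b, uniq (rcons r p),
    forall f, fcycle f (a ++ b) = fcycle f (rcons r p) & b ++ a = rcons r p].
  have [r [p E]] : exists r p, b ++ a = rcons r p.
    have : b ++ a != [::] by case: (a) (b) nab => [|? ?] [|? ?].
    by case/lastP: (b ++ a) => // r p _; exists r, p.
  exists r, p; split.
  - by move=> z; rewrite -E !mem_cat orbC.
  - by rewrite -E uniq_catC.
  - by move=> f; rewrite -E cycle_catC.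
  by rewrite E.
rewrite Eba /= rcons_path last_rcons => /and3P[/eqP sx pr /eqP sp].
(* The two transpositions take [x'] and then [x] out of the cycle. *)
pose sg1 := (tperm x' x * sg)%g.
pose sg2 := (tperm x p * sg1)%g.
have [npx npx'] : p != x /\ p != x'.
  have : p \in a ++ b by rewrite -mr mem_rcons mem_head.
  by move=> pab; split; apply: contraTneq pab => ->.
have [s2x s2x' s2p s2z] : [/\ sg2 x = x, sg2 x' = x', sg2 p = sg x' &
    forall z, z \notin [:: x; x'; p] -> sg2 z = sg z].
  rewrite /sg2 /sg1; split.
  - by rewrite !permM tpermL (@tpermD _ x' x p) ?sp // eq_sym.
  - by rewrite !permM (tpermD nxx' npx') tpermL sx.
  - by rewrite !permM tpermR tpermR.
  move=> z; rewrite !inE !negb_or => /and3P[h1 h2 h3].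
  by rewrite !permM !tpermD // eq_sym.
exists sg2; split => //.
- have -> : fcycle sg2 (a ++ b) = fpath sg2 p (rcons r p).
    by rewrite cyc -(rotr_cycle 1) rotr1_rcons.
  case: r mr ur pr {cyc Eba} => [|y r] mr ur /=; rewrite s2p => /andP[-> //].
  rewrite (@eq_fpath_belast _ sg sg2) // => z.
  rewrite belast_rcons => zr; rewrite s2z //.
  have zab : z \in a ++ b by rewrite -mr mem_rcons inE zr orbT.
  rewrite !inE !negb_or; apply/and3P; split.
  + by apply: contraTneq zab => ->.
  + by apply: contraTneq zab => ->.
  by apply: contraTneq ur => <-; rewrite rcons_uniq zr.
- by move=> z zab; apply: vL; rewrite memL zab !orbT.
- move=> z zV zab; case: (boolP (z \in a ++ x :: x' :: b)) => zL.
    have : (z == x) || (z == x') by move: zL; rewrite memL (negbTE zab) orbF.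
    have [xV x'V] : x.1 \in V /\ x'.1 \in V by split; apply: vL; rewrite memL eqxx ?orbT.
    by case/orP => /eqP ->; rewrite ?al2; apply/andP.
  have /andP[h ->] := clL _ zV zL.
  by rewrite andbT; move: h; rewrite memL !negb_or => /and3P[].
- move=> z zV zab.
  have [->|zx] := eqVneq z x; first by rewrite s2x.
  have [->|zx'] := eqVneq z x'; first by rewrite s2x'.
  rewrite s2z; first by apply: fL; rewrite // memL (negbTE zx) (negbTE zx').
  rewrite !inE !negb_or zx zx'; apply: contraNneq zab => ->.
  by rewrite -mr mem_rcons mem_head.
- move=> z zV; rewrite s2z ?outL //; rewrite !inE; apply: contra zV.
  case/or3P => /eqP ->; apply: vL; rewrite memL ?eqxx ?orbT //.
  by rewrite -mr mem_rcons mem_head !orbT.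
(* [x'] alone is a face; passing to [sg1] fuses it with the face of [x], and passing to [sg2] splits
   an orbit again. *)
have phix' : (al * sg)%g x' = x' by rewrite permM /x' al2 sx.
have c1 : #|porbits (al * sg)| = #|porbits (al * sg1)|.+1.
  rewrite /sg1 mul_tperm_l // [al x']al2.
  by apply: card_porbits_join; rewrite porbit_fix ?inE.
have c2 : #|porbits (al * sg2)| = #|porbits (al * sg1)|.+1.
  rewrite /sg2 mul_tperm_l //; apply: card_porbits_split.
    by rewrite (inj_eq perm_inj) eq_sym.
  apply/porbitP; exists 2; rewrite expgS expg1 !permM al2.
  by rewrite (tpermD (z := p)) 1?eq_sym // sp tpermL.
by move: card; rewrite c1 c2.
Qed.

Lemma mem_slots (i j : 'I_4) : j \in [:: i; sh i 1; sh i 2; sh i 3].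
Proof.
rewrite !inE -!val_eqE /= !val_sh; have := ltn_ord i; have := ltn_ord j; lia.
Qed.

Lemma uniq_slots (i : 'I_4) : uniq [:: i; sh i 1; sh i 2; sh i 3].
Proof.
rewrite /= !inE -!val_eqE /= !val_sh; have := ltn_ord i; lia.
Qed.

Definition slot n (d : 'I_n * 'I_4) k : 'I_n * 'I_4 := (d.1, sh d.2 k).

Lemma mem_crossing n (d z : 'I_n * 'I_4) :
  (z \in [:: d; slot d 1; slot d 2; slot d 3]) = (z.1 == d.1).
Proof.
case: d z => [c i] [c' j]; rewrite /slot !inE !xpair_eqE /= -!andb_orr.
by case: (c' =P c) => //= _; have := mem_slots i j; rewrite !inE.
Qed.

Lemma uniq_crossing n (d : 'I_n * 'I_4) : uniq [:: d; slot d 1; slot d 2; slot d 3].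
Proof.
by case: d => c i; rewrite /slot; have := uniq_slots i; rewrite /= !inE !xpair_eqE eqxx.
Qed.

(** The unvisited vertex is merged into the disc along the edge from [x], which is kept as a loop.
    This loop bounds a new one-dart face, making up for the unvisited crossing lost in
    [tour_card]. *)
Lemma tour_merge n (al rt sg : {perm 'I_n * 'I_4}) a x b V :
  (forall z, al (al z) = z) -> (forall z, rt z = slot z 1) ->
  tour al rt sg (a ++ x :: b) V -> let d := al x in d.1 \notin V ->
  exists sg', tour al rt sg'
    (a ++ x :: d :: [:: slot d 1; slot d 2; slot d 3] ++ b) (d.1 |: V).
Proof.
move=> al2 rtE [uL cL vL clL fL outL card] d dV.
set C := [:: d; slot d 1; slot d 2; slot d 3].
set L := a ++ x :: b in uL cL vL clL fL.
set L1 := a ++ _.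
have pL : perm_eq L1 (C ++ L).
  have -> : L1 = (a ++ [:: x]) ++ C ++ b by rewrite -catA.
  have -> : L = (a ++ [:: x]) ++ b by rewrite -catA.
  by rewrite perm_catCA.
have memL z : (z \in L1) = (z.1 == d.1) || (z \in L).
  by rewrite (perm_mem pL) mem_cat mem_crossing.
have xL : x \in L by rewrite mem_cat mem_head orbT.
have nxc : x.1 != d.1 by apply: contraNneq dV => <-; apply: vL.
have rt3 z : z.1 = d.1 -> sg z = slot z 1 by move=> e; rewrite outL ?rtE // e.
have s4 : slot (slot d 3) 1 = d by case: (d) => c i; rewrite /slot /= sh_sh sh4.
pose z3 := slot d 3.
have sz3 : sg z3 = d by rewrite rt3.
have nxz : x != z3 by apply: contraNneq nxc => ->.
(* Splices the cycle of the new crossing in after [x]: now [x] leads to [d], and [z3] to the former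
   successor of [x]. *)
pose sg1 := (tperm x z3 * sg)%g.
have s1x : sg1 x = d by rewrite permM tpermL.
have s1z : sg1 z3 = sg x by rewrite permM tpermR.
have s1o z : z != x -> z != z3 -> sg1 z = sg z.
  by move=> h1 h2; rewrite permM tpermD 1?eq_sym.
exists sg1; split.
- rewrite (perm_uniq pL) cat_uniq uniq_crossing uL andbT /=.
  apply/hasPn => z zL; rewrite mem_crossing.
  by apply: contraNneq dV => <-; apply: vL.
- have : fcycle sg (x :: b ++ a) by have := cL; rewrite cycle_catC.
  rewrite cycle_catC /= => pr.
  have d1 : d.1 = (slot d 1).1 by [].
  have sl k : slot (slot d k) 1 = slot d k.+1.
    by rewrite /slot /= sh_sh addn1.
  have nz3 k : k < 3 -> slot d k != z3.
    move=> k3; rewrite /z3 /slot xpair_eqE eqxx -val_eqE /= !val_sh.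
    by have := ltn_ord d.2; lia.
  have d0 : d = slot d 0.
    by rewrite /slot; case: (d) => c i /=; congr pair; apply: val_inj;
      rewrite /= val_sh addn0 modn_small.
  have nxs k : slot d k != x by apply: contraNneq nxc => <-.
  have s1k k : k < 3 -> sg1 (slot d k) = slot d k.+1.
    by move=> k3; rewrite s1o ?nz3 // rt3 ?sl.
  have s1d : sg1 d = slot d 1 by rewrite {1}d0 s1k.
  rewrite s1x s1d !s1k // !eqxx /=.
  have nba z : z \in b ++ a -> (z != x) && (z != z3).
    rewrite mem_cat orbC -mem_cat => zab; apply/andP; split.
      apply: contraTneq zab => ->; move: uL; rewrite /L -cat1s uniq_catCA /=.
      by case/andP.
    apply: contraNneq dV => z3E; rewrite -[d.1]/(z3.1) -z3E; apply: vL.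
    by move: zab; rewrite !mem_cat inE => /orP[]->; rewrite ?orbT.
  case: (b ++ a) pr nba => [|y r] /=; rewrite s1z => /andP[-> //] pr nba.
  rewrite (@eq_fpath_belast _ sg1 sg) // => z; rewrite belast_rcons.
  by move=> /nba/andP[? ?]; apply: s1o.
- by move=> z; rewrite memL => /orP[h|/vL h]; rewrite in_setU1 h ?orbT.
- move=> z; rewrite !memL negb_or !in_setU1 => /orP[->//|zV] /andP[nz zL].
  have /andP[h1 h2] := clL _ zV zL; rewrite h2 orbT andbT negb_or h1 andbT.
  by apply: contraNneq dV => <-.
- move=> z; rewrite !memL negb_or !in_setU1 => /orP[->//|zV] /andP[nz zL].
  rewrite s1o ?fL //; first by apply: contraNneq zL => ->.
  by apply: contraNneq nz => ->.
- move=> z; rewrite in_setU1 negb_or => /andP[nz zV].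
  rewrite s1o ?outL //; first by apply: contraNneq zV => ->; apply: vL.
  by apply: contraNneq nz => ->.
have cC : #|~: V| = #|~: (d.1 |: V)|.+1.
  rewrite (cardsD1 d.1 (~: V)) inE dV add1n; congr _.+1.
  by apply: eq_card => z; rewrite !inE negb_or.
suff cF : #|porbits (al * sg1)| = #|porbits (al * sg)|.+1.
  by rewrite cF addSnnS -cC.
(* The face that splits off is that of [d], a fixed point of [al * sg1]. *)
rewrite /sg1 mul_tperm_l //; apply: card_porbits_split; first by rewrite (inj_eq perm_inj).
by apply/porbitP; exists 1; rewrite expg1 permM al2 sz3.
Qed.

(** Gluing a crossing tile hides the connecting edge inside the disc: merge along it, then cancel
    the resulting loop. *)
Lemma tour_cross n (al rt sg : {perm 'I_n * 'I_4}) a x b V :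
  (forall z, al (al z) = z) -> (forall z, rt z = slot z 1) ->
  tour al rt sg (a ++ x :: b) V -> (al x).1 \notin V ->
  exists sg', tour al rt sg'
    (a ++ [:: slot (al x) 1; slot (al x) 2; slot (al x) 3] ++ b) ((al x).1 |: V).
Proof.
move=> al2 rtE t xV; have [sg1 t1] := tour_merge al2 rtE t xV.
by apply: tour_cap t1 => //; case: a {t}.
Qed.

(** The [n + 2] faces of a sphere diagram and the [n - 1] unvisited crossings add up to exactly
    [2 * n + 1]. *)
Lemma tour_start n (al rt : {perm 'I_n * 'I_4}) (d : 'I_n * 'I_4) :
  (forall z, rt z = slot z 1) -> #|porbits (al * rt)| = n + 2 ->
  tour al rt rt [:: d; slot d 1; slot d 2; slot d 3] [set d.1].
Proof.
move=> rtE c; split.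
- exact: uniq_crossing.
- rewrite /= !rtE /slot /= !sh_sh !eqxx /=; case: d => e i /=; by rewrite sh4 eqxx.
- by move=> x; rewrite mem_crossing inE.
- by move=> x; rewrite mem_crossing inE => ->.
- by move=> x; rewrite mem_crossing inE => ->.
- by [].
have := cardsC [set d.1]; rewrite cards1 card_ord c.
by move: #|_| => m; lia.
Qed.

Lemma mem_split (T : eqType) (s : seq T) x : x \in s -> exists a b, s = a ++ x :: b.
Proof. by move=> /splitPr[a b]; exists a, b. Qed.

(* When every crossing is visited the Euler bound leaves at least two fixed
   points of [al * sg], hence two cancelling neighbours in the cyclic word;
   only one of them can straddle the ends of the linear word. *)
Lemma tour_adjacent n (al rt sg : {perm 'I_n * 'I_4}) L :
  (forall z, al (al z) = z) -> (forall z, al z != z) ->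
  tour al rt sg L setT -> exists a x b, L = a ++ x :: al x :: b.
Proof.
move=> al2 aln [uL cL vL clL fL outL card].
have [] := @two_fixpoints _ (al * sg)%g.
  by rewrite card_prod !card_ord; move: card; rewrite setCT cards0; lia.
move=> x [y [nxy fx fy]].
(* A fixed point [z] satisfies [sg (al z) = z]; outside the word [sg] would fix [al z], giving
   [al z = z]. *)
have fixL z : (al * sg)%g z = z -> al z \in L.
  rewrite permM => sz; apply: contraT => azL.
  by have := aln z; rewrite -{2}sz fL ?inE // eqxx.
have nexta z : (al * sg)%g z = z -> next L (al z) = z.
  by move=> fz; rewrite (nextE cL) ?fixL // -permM.
suff key z : al z \in L -> next L (al z) = z -> al z != last z L ->
    exists a x b, L = a ++ x :: al x :: b.
  have [ex|] := boolP (al x != last x L); first by apply: key ex; auto.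
  rewrite negbK => /eqP lx; apply: (key y); auto.
  have -> : last y L = last x L by case: (L) (fixL _ fx).
  by rewrite -lx (inj_eq perm_inj) eq_sym.
move=> aL; have [a [b E]] := mem_split aL.
case: b E => [|w b] E; rewrite E; first by rewrite last_cat eqxx.
have -> : next (a ++ al z :: w :: b) (al z) = w.
  have un : uniq (al z :: w :: (b ++ a)) by have := uL; rewrite E uniq_catC.
  rewrite -[a ++ _](rotK (size a)) rot_size_cat next_rotr // /= eqxx //.
by move=> -> _; exists a, (al z), b; rewrite al2.
Qed.

(* An involution [al] reversing an [al \o st]-orbit would act on it as a
   reflection, and then [al] or [st] would have a fixed point. *)
Lemma strand_disjoint (T : finType) (al st : T -> T) x :
  involutive al -> involutive st -> (forall z, al z != z) -> (forall z, st z != z) ->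
  ~~ fconnect (fun z => st (al z)) x (al x).
Proof.
move=> al2 st2 aln stn; set f := fun z => _; apply/negP => /iter_findex.
move: (findex _ _ _) => a ax.
have f_alf z : f (al (f z)) = al z by rewrite /f al2 st2.
have alf i z : iter i f (al (iter i f z)) = al z.
  by elim: i z => // i IH z; rewrite iterSr iterS f_alf IH.
have injf : injective f by move=> u v /(inv_inj st2) /(inv_inj al2).
have injif i : injective (iter i f) by elim: i => [|i IH] u v //= /injf /IH.
(* The parity of the distance tells whether the midpoint yields a fixed point of [al] or of [st]. *)
have [b [E|E]] : exists b, a = b + b \/ a = (b + b).+1.
  by exists a./2; lia.
- have /injif e : iter b f (al (iter b f x)) = iter b f (iter b f x).
    by rewrite alf -iterD -E ax.
  by have := aln (iter b f x); rewrite e eqxx.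
have /injif e : iter b f (al (iter b f x)) = iter b f (iter b.+1 f x).
  by rewrite alf -iterD addnS -E ax.
by have := stn (al (iter b f x)); rewrite -[st _]/(f _) -iterS -e eqxx.
Qed.

(** [x] and [al x] lie in different orbits, the two directions of the strand, so a dart outside both
    would give a third orbit. *)
Lemma strand_cover (T : finType) (al st : T -> T) :
  involutive al -> involutive st -> (forall z, al z != z) -> (forall z, st z != z) ->
  let f := fun z => st (al z) in norbits f = 2 ->
  forall x y, fconnect f x y \/ fconnect f (al x) y.
Proof.
move=> al2 st2 aln stn f nf x y.
have injf : injective f by move=> u v /(inv_inj st2) /(inv_inj al2).
pose cl x := [set y | fconnect f x y].
have clE u v : (cl u == cl v) = fconnect f u v.
  apply/eqP/idP => [e|c].
    have : v \in cl u by rewrite e inE connect0.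
    by rewrite inE.
  by apply/setP => w; rewrite !inE (same_connect (fconnect_sym injf) c).
have /negP nx := strand_disjoint x al2 st2 aln stn.
apply/orP; rewrite -!clE; apply: contraT; rewrite negb_or => /andP[n1 n2].
have : #|[set cl x; cl (al x); cl y]| <= norbits f.
  by apply/subset_leq_card/subsetP => S; rewrite !inE => /orP[/orP[]|] /eqP ->;
    apply: imset_f.
rewrite nf cardsU cards2 cards1 clE (introF idP nx) /=.
have -> : [set cl x; cl (al x)] :&: [set cl y] = set0.
  apply/setP => S; rewrite !inE; apply/negP => /andP[/orP[] /eqP -> h].
    by rewrite h in n1.
  by rewrite h in n2.
by rewrite cards0.
Qed.

(** If every open end led back into [V], the darts over [V] would be stable under following strands,
    and the single strand visits every crossing. *)
Lemma tour_next_crossing n (al rt sg : {perm 'I_n * 'I_4}) (st : _ -> _) L V :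
  (forall z, al (al z) = z) -> (forall z, st z = slot z 2) ->
  (forall x y, fconnect (fun z => st (al z)) x y \/
               fconnect (fun z => st (al z)) (al x) y) ->
  tour al rt sg L V -> V != set0 -> V != setT ->
  exists a x b, L = a ++ x :: b /\ (al x).1 \notin V.
Proof.
move=> al2 stE cov [uL cL vL clL fL outL card] /set0Pn[c cV] VT.
have [/hasP[x /mem_split[a [b E]] xV]|noV] := boolP (has (fun x => (al x).1 \notin V) L).
  by exists a, x, b.
have alV x : x.1 \in V -> (al x).1 \in V.
  move=> xV; have [xL|xL] := boolP (x \in L); last by case/andP: (clL x xV xL).
  by move/hasPn: noV => /(_ _ xL); rewrite negbK.
have conV x y : x.1 \in V -> fconnect (fun z => st (al z)) x y -> y.1 \in V.
  move=> xV /iter_findex <-; elim: (findex _ _ _) => //= i IH.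
  by rewrite stE /= alV.
case/negP: VT; apply/eqP/setP => e; rewrite inE.
have := cov (c, ord0) (e, ord0) => -[] /conV; last by apply; apply: alV.
by apply.
Qed.

(* The row is grown by tiles on the right.  In [reach u x v V] the crossings of
   [V] have been placed, [x] is the dart whose strand leaves through the right
   end of the row, [u] and [v] are the darts whose strands are still open along
   the bottom (or at the left end) and along the top, rightmost first. *)
Inductive reach n (al : 'I_n * 'I_4 -> 'I_n * 'I_4) :
    seq ('I_n * 'I_4) -> 'I_n * 'I_4 -> seq ('I_n * 'I_4) -> {set 'I_n} -> Prop :=
| ReachStart d : reach al [:: slot d 1; d] (slot d 2) [:: slot d 3] [set d.1]
| ReachLeft y u x v V : reach al (y :: u) x v V -> reach al u y (x :: v) V
| ReachRight y u x v V : reach al u x (y :: v) V -> reach al (x :: u) y v V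
| ReachCross u x v V : reach al u x v V -> (al x).1 \notin V ->
    reach al (slot (al x) 1 :: u) (slot (al x) 2) (slot (al x) 3 :: v) ((al x).1 |: V)
| ReachCapTop y u x v V : reach al (y :: u) x (al x :: v) V -> reach al u y v V
| ReachCapBottom y u x v V : reach al (al x :: u) x (y :: v) V -> reach al u y v V.

Lemma reach_catrev n (al : 'I_n * 'I_4 -> _) u x v V a y b :
  reach al u x v V -> x :: v = a ++ y :: b -> reach al (catrev a u) y b V.
Proof.
elim: a u x v => [|z a IH] u x v r /= [E1 E2]; first by rewrite -E1 -E2.
rewrite -E1; case: v E2 r => [|w v] E2 r; first by case: (a) E2.
by apply: IH E2; apply: ReachRight.
Qed.

(** The linear boundary word is [rev u ++ x :: v]; bends leave it unchanged and only carry the focus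
    along it. *)
Lemma reach_refocus n (al : 'I_n * 'I_4 -> _) u x v V a y b :
  reach al u x v V -> rev u ++ x :: v = a ++ y :: b -> reach al (rev a) y b V.
Proof.
elim: u x v => [|z u IH] x v r; first by apply: reach_catrev.
by rewrite rev_cons cat_rcons; apply: IH; apply: ReachLeft.
Qed.

(** The number of unvisited crossings decreases to zero, then the length of the word decreases until
    the two darts of a single edge are left, to be joined at the right end of the row. *)
Lemma reach_complete n (al rt sg : {perm 'I_n * 'I_4}) (st : _ -> _) u x v V :
  (forall z, al (al z) = z) -> (forall z, al z != z) ->
  (forall z, rt z = slot z 1) -> (forall z, st z = slot z 2) ->
  (forall x y, fconnect (fun z => st (al z)) x y \/
               fconnect (fun z => st (al z)) (al x) y) ->
  reach al u x v V -> tour al rt sg (rev u ++ x :: v) V ->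
  exists y, reach al [:: al y] y [::] setT.
Proof.
move=> al2 aln rtE stE cov r t.
(* Quantifying over the decompositions of [L] forgets the current focus: any letter may serve. *)
have [L [sg1 [t1 r1]]] : exists L sg1, tour al rt sg1 L setT /\
    forall a y b, L = a ++ y :: b -> reach al (rev a) y b setT.
  have [m] := ubnP #|~: V|; elim: m u x v V sg r t => // m IH u x v V sg r t.
  rewrite ltnS => hm.
  have [E|VT] := eqVneq V setT.
    by exists (rev u ++ x :: v), sg; rewrite -E; split=> // a y b; apply: reach_refocus.
  have V0 : V != set0.
    apply/set0Pn; exists x.1; apply: (tour_visited t).
    by rewrite mem_cat mem_head orbT.
  have [a [y [b [E yV]]]] := tour_next_crossing al2 stE cov t V0 VT.
  have ry := ReachCross (reach_refocus r E) yV.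
  rewrite E in t; have [sg1 t1] := tour_cross al2 rtE t yV.
  apply: IH ry _ _; first by rewrite rev_cons revK cat_rcons; apply: t1.
  apply: leq_trans hm; apply: proper_card; rewrite properC.
  by apply: properUr; rewrite sub1set.
have [m] := ubnP (size L); elim: m L sg1 t1 r1 => // m IH L sg1 t1 r1.
have [a [y [b E]]] := tour_adjacent al2 aln t1; rewrite ltnS => hm.
have [/nilP|nab] := boolP (nilp (a ++ b)).
  case: a b E => [|? ?] [|? ?] // E _; exists (al y); rewrite al2.
  by apply: (r1 [:: y] _ [::]).
rewrite E in t1; have nab' : a ++ b != [::] by case: (a ++ b) nab.
have [sg2 t2] := tour_cap al2 nab' t1.
apply: (IH _ sg2 t2); last by move: hm; rewrite E !size_cat /= !addnS => /ltnW.
(* Cancelling a pair needs a further neighbour to become the focus: the letter on its right if the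
   pair begins the word, the one on its left otherwise. *)
case: a E nab {t1 t2 nab'} => [|z a] E nab.
  case: b E nab => [|w b] E // _ c z d.
  have r2 : reach al [::] w b setT.
    by apply: (@ReachCapBottom _ al w [::] (al y)); rewrite al2; apply: (r1 [:: y]).
  by move=> Ec; apply: (reach_refocus r2).
have [c [z' Ea]] : exists c z', z :: a = rcons c z'.
  by exists (belast z a), (last z a); rewrite lastI.
rewrite {}Ea in E nab *; move=> c' w d; rewrite cat_rcons => Ec.
apply: (@reach_refocus _ al (rev c) z' b); last by rewrite revK.
by apply: (@ReachCapTop _ al _ _ y); have := r1 _ _ _ E; rewrite rev_rcons.
Qed.

(** * Port matchings and vertices of a row *)

(* The port [(j, s)] is side [s] of the tile in column [j]. *)
Notation cport := (nat * nat)%type.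

Fixpoint cports k : seq cport :=
  if k is j.+1 then [:: (j, 0), (j, 1), (j, 2), (j, 3) & cports j] else [::].

Lemma mem_cports k j s : ((j, s) \in cports k) = (j < k) && (s < 4).
Proof.
by elim: k => [//|k IH]; rewrite !inE IH !xpair_eqE; lia.
Qed.

Lemma cports_uniq k : uniq (cports k).
Proof.
elim: k => //= k ->; rewrite !inE !xpair_eqE !eqxx /= !mem_cports ltnn.
by rewrite !andbT.
Qed.

Fixpoint unpair (A : seq (cport * cport)) : seq cport :=
  if A is a :: A' then [:: a.1, a.2 & unpair A'] else [::].

Lemma mem_unpair A y y' : (y, y') \in A -> (y \in unpair A) /\ (y' \in unpair A).
Proof.
elim: A => //= [[a b] A IH]; rewrite !inE xpair_eqE.
by case/orP => [/andP[-> ->]|/IH[-> ->]]; rewrite ?orbT.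
Qed.

(* Ends, as lattice points (row, column), of a side oriented counterclockwise
   around its own tile. *)
Definition point0 (y : cport) : cport :=
  match y.2 with
  | 0 => (1, y.1.+1) | 1 => (0, y.1.+1) | 2 => (0, y.1) | _ => (1, y.1)
  end.

Definition point1 (y : cport) : cport :=
  match y.2 with
  | 0 => (0, y.1.+1) | 1 => (0, y.1) | 2 => (1, y.1) | _ => (1, y.1.+1)
  end.

Definition outer (y : cport) := [|| y.2 == 1, y.2 == 3 | y == (0, 2)].

Fixpoint chain (lab : cport -> nat) a (s : seq cport) b : Prop :=
  if s is y :: s' then lab (point0 y) = a /\ chain lab (lab (point1 y)) s' b
  else a = b.

Lemma chain_cat lab a b s1 s2 :
  chain lab a (s1 ++ s2) b <-> exists2 c, chain lab a s1 c & chain lab c s2 b.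
Proof.
elim: s1 a => [|y s1 IH] a /=.
  by split=> [h|[c -> //]]; exists a.
split=> [[h /IH[c h1 h2]]|[c [h1 h2] h3]]; first by exists c.
by split=> //; apply/IH; exists c.
Qed.

Lemma eq_chain lab lab' a s b :
  (forall y, y \in s ->
     lab' (point0 y) = lab (point0 y) /\ lab' (point1 y) = lab (point1 y)) ->
  chain lab a s b -> chain lab' a s b.
Proof.
elim: s a => //= y s IH a h; have [-> ->] := h y (mem_head _ _).
by case=> -> c; split=> //; apply: IH => // z zs; apply: h; rewrite inE zs orbT.
Qed.

(* [lab] labels the lattice points so that glued points get equal labels, and
   it takes at least [c] values.  Every boundary edge of the row, run
   counterclockwise from the left end, is either glued or open; the open ones
   form a closed chain, so that gluing adjacent open edges costs one label. *)
Record geom k (A : seq (cport * cport)) (pu pv : seq cport)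
    (lab : cport -> nat) c : Prop := Geom {
  geom_perm : perm_eq (cports k.+1) ((k, 0) :: pu ++ pv ++ unpair A);
  geom_wall : forall j, j < k -> ((j, 0), (j.+1, 2)) \in A;
  geom_outer : forall a, a \in A ->
    (exists j, a = ((j, 0), (j.+1, 2))) \/ outer a.1 && outer a.2;
  geom_open : all outer (pu ++ pv);
  geom_lab : forall l, l < c -> exists r q, [/\ r < 2, q <= k.+1 & lab (r, q) = l];
  geom_glue : forall y y', (y, y') \in A ->
    lab (point0 y) = lab (point1 y') /\ lab (point1 y) = lab (point0 y');
  geom_chain : exists a, chain lab a (rev pu ++ (k, 0) :: pv) a;
  geom_count : 2 * c = (size pu + size pv).+1 + 2 * k.+1 + 2 }.

(** [Some y] glues the bottom or top side [q] of a new tile to the adjacent open side [y], while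
    [None] leaves [q] open. One lemma then covers bends, caps and crossings. *)
Definition ocons (o : option cport) s := if o is Some y then y :: s else s.
Definition olink (o : option cport) (q : cport) := if o is Some y then [:: (y, q)] else [::].
Definition oopen (o : option cport) (q : cport) s := if o is Some _ then s else q :: s.

Lemma geom_start : exists lab, geom 0 [::] [:: (0, 3); (0, 2)] [:: (0, 1)] lab 4.
Proof.
(* Distinct labels 0 to 3 for the corners of a tile with no glued side. *)
exists (fun p => p.1 + 2 * p.2); split=> //.
  move=> l hl; exists (odd l), l./2; split; [by case: (odd l)| |] => /=; lia.
by exists 0.
Qed.

(** The new column adds two lattice points. A glued side forces the label of its new corner, and the
    chain condition makes its other corner agree; an open side contributes one more label. *)
Lemma geom_append k A o1 o2 pu pv lab c :
  geom k A (ocons o1 pu) (ocons o2 pv) lab c ->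
  exists lab' c', geom k.+1
    (((k, 0), (k.+1, 2)) :: olink o1 (k.+1, 3) ++ olink o2 (k.+1, 1) ++ A)
    (oopen o1 (k.+1, 3) pu) (oopen o2 (k.+1, 1) pv) lab' c'.
Proof.
case=> gp gw go gop gl gg [a gc] gn.
(* [l1] labels the new lower corner and [l2] the upper one; [c] is the next label to be attained,
   and the upper corner takes [c.+1] when the lower one has taken [c]. *)
have [l1 [l1S l1N]] : exists l1,
    (forall y, o1 = Some y -> l1 = lab (point0 y)) /\ (o1 = None -> l1 = c).
  by case: (o1) => [y|]; [exists (lab (point0 y)) | exists c]; split=> // ? [->].
have [l2 [l2S l2N]] : exists l2, (forall y, o2 = Some y -> l2 = lab (point1 y)) /\
    (o2 = None -> l2 = c + (o1 == None)).
  by case: (o2) => [y|]; [exists (lab (point1 y)) | eexists]; split=> // ? [->].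
have [lab' [labE labN1 labN0]] : exists lab', [/\ forall r q, q <= k.+1 ->
    lab' (r, q) = lab (r, q), lab' (1, k.+2) = l1 & lab' (0, k.+2) = l2].
  exists (fun p => if p == (1, k.+2) then l1 else if p == (0, k.+2) then l2 else lab p).
  split=> [r q qk||]; rewrite ?eqxx // !xpair_eqE.
  by rewrite !(@ltn_eqF q k.+2 qk) !andbF.
have old y : y \in (k, 0) :: ocons o1 pu ++ ocons o2 pv ++ unpair A ->
    lab' (point0 y) = lab (point0 y) /\ lab' (point1 y) = lab (point1 y).
  rewrite -(perm_mem gp); case: y => j s; rewrite mem_cports => /andP[jk _].
  by case: s => [|[|[|s]]]; rewrite /point0 /point1 /= !labE // ltnW.
have oldu y : y \in ocons o1 pu ->
    lab' (point0 y) = lab (point0 y) /\ lab' (point1 y) = lab (point1 y).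
  by move=> h; apply: old; rewrite inE mem_cat h orbT.
have oldv y : y \in ocons o2 pv ->
    lab' (point0 y) = lab (point0 y) /\ lab' (point1 y) = lab (point1 y).
  by move=> h; apply: old; rewrite inE !mem_cat h !orbT.
have oldA y y' : (y, y') \in A -> [/\ lab' (point0 y) = lab (point0 y),
    lab' (point1 y) = lab (point1 y), lab' (point0 y') = lab (point0 y') &
    lab' (point1 y') = lab (point1 y')].
  move=> /mem_unpair[h1 h2]; have [|-> ->] := old y.
    by rewrite inE !mem_cat h1 !orbT.
  by have [|-> ->] := old y'; rewrite // inE !mem_cat h2 !orbT.
(* The closed chain is cut around the focus and the sides about to be glued. *)
have [cu [cv [ch1 ch2 ch3]]] : exists cu cv, [/\ chain lab a (rev pu) cu,
    chain lab cu (ocons o1 [::] ++ (k, 0) :: ocons o2 [::]) cv & chain lab cv pv a].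
  have E : rev (ocons o1 pu) ++ (k, 0) :: ocons o2 pv =
      rev pu ++ (ocons o1 [::] ++ (k, 0) :: ocons o2 [::]) ++ pv.
    by case: (o1) (o2) => [y|] [y'|] /=; rewrite ?rev_cons ?cat_rcons.
  move: gc; rewrite E => /chain_cat[cu h1 /chain_cat[cv h2 h3]].
  by exists cu, cv.
exists lab', (c + (o1 == None) + (o2 == None)); split.
- apply/seq.permP => p; move/seq.permP: gp => /(_ p).
  rewrite -[cports k.+2]/([:: (k.+1, 0); (k.+1, 1); (k.+1, 2); (k.+1, 3)] ++ cports k.+1).
  rewrite count_cat => ->.
  by case: (o1) (o2) => [y|] [y'|]; rewrite /= !count_cat /= ?count_cat /=; lia.
- move=> j; rewrite ltnS leq_eqVlt => /orP[/eqP ->|jk]; first exact: mem_head.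
  by rewrite inE !mem_cat gw // !orbT.
- move=> b; rewrite inE => /orP[/eqP ->|]; first by left; exists k.
  rewrite !mem_cat => /or3P[||/go //]; rewrite /olink.
    case: (o1) gop => // y /= /andP[oy _]; rewrite inE => /eqP -> /=.
    by right; rewrite oy.
  case: (o2) gop => // y; rewrite all_cat /= => /andP[_ /andP[oy _]].
  by rewrite inE => /eqP -> /=; right; rewrite oy.
- move: gop; rewrite !all_cat => /andP[h1 h2]; apply/andP; split.
    by case: (o1) h1 => [y /andP[]|].
  by case: (o2) h2 => [y /andP[]|].
- move=> l hl; case: (ltnP l c) => [/gl[r [q [r2 qk <-]]]|lc].
    by exists r, q; rewrite labE ?(leq_trans qk).
  have [o1N|o1N] := eqVneq o1 None; last first.
    have o2N : o2 = None by move: hl; rewrite (negbTE o1N); case: (o2) => //=; lia.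
    exists 0, k.+2; split=> //; rewrite labN0 l2N // (negbTE o1N).
    by move: hl; rewrite o2N (negbTE o1N) /=; lia.
  have [->|lc'] := eqVneq l c; first by exists 1, k.+2; split; rewrite ?labN1 ?l1N.
  have o2N : o2 = None by move: hl; rewrite o1N; case: (o2) => //=; lia.
  exists 0, k.+2; split=> //; rewrite labN0 l2N // o1N.
  by move: hl; rewrite o2N o1N /=; lia.
- move=> y y'; rewrite inE => /orP[/eqP[-> ->]|].
    by rewrite /point0 /point1.
  rewrite !mem_cat => /or3P[||/[dup] /gg [e1 e2] /oldA [-> -> -> ->] //].
    case: (o1) l1S oldu ch2 => [y1|] // l1S oldu ch2.
    rewrite inE => /eqP[-> ->]; have [|-> ->] := oldu y1; first exact: mem_head.
    by rewrite /point0 /point1 /= labN1 labE // (l1S y1) //; case: ch2 => _ [<-].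
  case: (o2) l2S oldv ch2 => [y2|] // l2S oldv ch2.
  rewrite inE => /eqP[-> ->]; have [|-> ->] := oldv y2; first exact: mem_head.
  rewrite /point0 /point1 /= labN0 labE // (l2S y2) //.
  by case: (o1) ch2 => [y1|] /= => [[_]|] [_ [-> _]].
- exists a; have -> : rev (oopen o1 (k.+1, 3) pu) ++ (k.+1, 0) :: oopen o2 (k.+1, 1) pv =
      rev pu ++ ((if o1 is Some _ then [::] else [:: (k.+1, 3)]) ++ 
       (k.+1, 0) :: (if o2 is Some _ then [::] else [:: (k.+1, 1)])) ++ pv.
    by case: (o1) (o2) => [y|] [y'|] /=; rewrite ?rev_cons ?cat_rcons.
  apply/chain_cat; exists cu; first apply: eq_chain ch1.
    by move=> y; rewrite mem_rev => yu; apply: oldu; case: (o1) => //= z; rewrite inE yu orbT.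
  apply/chain_cat; exists cv; last apply: eq_chain ch3.
    case: (o1) (o2) l1S l2S ch2 => [y1|] [y2|] l1S l2S /=;
    rewrite /point0 /point1 /= ?labN1 ?labN0 ?labE //.
    + by rewrite (l1S y1) // (l2S y2) //; intuition congruence.
    + by rewrite (l1S y1) //; intuition congruence.
    + by rewrite (l2S y2) //; intuition congruence.
    by intuition congruence.
  by move=> y yv; apply: oldv; case: (o2) => //= z; rewrite inE yv orbT.
by move: gn; case: (o1) (o2) => [y|] [y'|] /=; lia.
Qed.

(** * Strands of a row *)

Definition crossb t := (t == 9) || (t == 10).
Definition through t s := odflt s (conn_nat t s).

Definition step (tl : nat -> nat) (ad : cport -> cport) (q : cport) :=
  if crossb (tl q.1) then q else ad (q.1, through (tl q.1) q.2).

(* Everything about a partial row is stated for all tilings [tl] and port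
   adjacencies [ad] extending it, so that it survives the later gluings. *)
Definition fits (ts : seq nat) (A : seq (cport * cport)) tl ad :=
  (forall j, j < size ts -> tl j = nth 0 ts j) /\
  (forall y y', (y, y') \in A -> ad y = y' /\ ad y' = y).

(* [leads ts A p y]: the strand leaving a crossing through the port [p] reaches
   the open side [y]; the second clause follows it backwards. *)
Definition leads ts A (p y : cport) := forall tl ad, fits ts A tl ad ->
  (exists i, iter i (step tl ad) (ad p) = ad y) /\
  (exists i, iter i (step tl ad) y = p).

Definition joins ts A (p q : cport) := forall tl ad, fits ts A tl ad ->
  exists i, iter i (step tl ad) (ad p) = q.

(** Connectedness before the mosaic exists: [C] is any symmetric transitive relation containing the
    gluings and the arcs of the tiles, later instantiated with [connect] of [mrel]. *)
Definition covers ts A (Q : cport -> Prop) := forall j s, j < size ts -> s < 4 ->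
  forall tl ad, fits ts A tl ad -> forall C : cport -> cport -> Prop,
  (forall p q, C p q -> C q p) -> (forall p q r, C p q -> C q r -> C p r) ->
  (forall p, p.1 < size ts -> p.2 < 4 -> C p (p.1, through (tl p.1) p.2)) ->
  (forall y y', (y, y') \in A -> C y y') ->
  exists2 p, C (j, s) p & Q p.

Lemma fits_sub ts A t A' tl ad :
  {subset A <= A'} -> fits (rcons ts t) A' tl ad -> fits ts A tl ad.
Proof.
move=> sA [h1 h2]; split=> [j jk|y y' /sA]; last exact: h2.
by rewrite h1 ?size_rcons ?ltnS ?(ltnW jk) // nth_rcons jk.
Qed.

Lemma fits_last ts A t tl ad : fits (rcons ts t) A tl ad -> tl (size ts) = t.
Proof. by case=> h _; rewrite h ?size_rcons // nth_rcons ltnn eqxx. Qed.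

Lemma leads_refl ts A p : leads ts A p p.
Proof. by move=> tl ad _; split; exists 0. Qed.

Lemma leads_mono ts A t A' p y :
  {subset A <= A'} -> leads ts A p y -> leads (rcons ts t) A' p y.
Proof. by move=> sA h tl ad /(fits_sub sA); apply: h. Qed.

Lemma joins_mono ts A t A' p y :
  {subset A <= A'} -> joins ts A p y -> joins (rcons ts t) A' p y.
Proof. by move=> sA h tl ad /(fits_sub sA); apply: h. Qed.

(** The strand enters the bend by side [s] and leaves by [s']; the two equations on [through] serve
    the forward and the backward walk. *)
Lemma leads_bend ts A t p y s s' :
  leads (rcons ts t) A p y -> (y, (size ts, s)) \in A -> ~~ crossb t ->
  through t s = s' -> through t s' = s -> leads (rcons ts t) A p (size ts, s').
Proof.
move=> h yA nc e e' tl ad F; have [[i h1] [j h2]] := h tl ad F.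
have tlE := fits_last F; have [a1 a2] := F.2 _ _ yA.
split; first by exists i.+1; rewrite iterS h1 a1 /step /= tlE (negbTE nc) e.
by exists j.+1; rewrite iterSr /step /= tlE (negbTE nc) e' a2.
Qed.

(** Walk forwards from one crossing to the gluing of [y] and [y'], then follow the backward walk of
    the other strand to its crossing. *)
Lemma leads_join ts A p y q y' : (y, y') \in A ->
  leads ts A p y -> leads ts A q y' -> joins ts A p q /\ joins ts A q p.
Proof.
move=> yA hp hq; split=> tl ad F; have [a1 a2] := F.2 _ _ yA;
  have [[i h1] [j h2]] := hp tl ad F; have [[i' h1'] [j' h2']] := hq tl ad F.
  by exists (j' + i); rewrite iterD h1 a1.
by exists (j + i'); rewrite iterD h1' a2.
Qed.

(** A side of the new tile may be connected merely to a side of an older tile, where the hypothesis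
    on [ts] takes over. *)
Lemma covers_append ts A t A' Q Q' :
  {subset A <= A'} -> (forall p, Q p -> Q' p) -> covers ts A Q ->
  (forall s, s < 4 -> forall tl ad, fits (rcons ts t) A' tl ad ->
   forall C : cport -> cport -> Prop,
   (forall p q, C p q -> C q p) -> (forall p q r, C p q -> C q r -> C p r) ->
   (forall s, s < 4 -> C (size ts, s) (size ts, through t s)) ->
   (forall y y', (y, y') \in A' -> C y y') ->
   exists2 p, C (size ts, s) p & Q' p \/ exists j s', [/\ p = (j, s'), j < size ts & s' < 4]) ->
  covers (rcons ts t) A' Q'.
Proof.
move=> sA QQ h hnew j s; rewrite size_rcons => jk s4 tl ad F C Cs Ct Cc CA.
have old j' s' : j' < size ts -> s' < 4 -> exists2 p, C (j', s') p & Q' p.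
  move=> j'k s'4; have [] := h j' s' j'k s'4 tl ad (fits_sub sA F) C Cs Ct.
  - by move=> p hp; apply: Cc; apply: leq_trans hp _.
  - by move=> y y' /sA; apply: CA.
  by move=> p c q; exists p => //; apply: QQ.
move: jk; rewrite ltnS leq_eqVlt => /orP[/eqP ->|jk]; last exact: old.
have [|p c [q|[j' [s' [pE j'k s'4]]]]] := hnew s s4 tl ad F C Cs Ct _ CA.
- by move=> s' s'4; have := Cc (size ts, s') (leqnn _) s'4; rewrite /= (fits_last F).
- by exists p.
have [p' c' q'] := old _ _ j'k s'4; exists p' => //.
by apply: Ct c' ; rewrite -pE.
Qed.


(* Crossing [c] sits in column [e c], turned so that its slot [i] is on side
   [i + r c]. *)
Definition prt n (e r : 'I_n -> nat) (d : 'I_n * 'I_4) : cport :=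
  (e d.1, (d.2 + r d.1) %% 4).

(** The under strand occupies the even slots of a crossing, the even sides of [T9] and the odd sides
    of [T10]; hence the tile number [9 + odd (r c)]. *)
Record tiles n k ts (e r : 'I_n -> nat) (V : {set 'I_n}) : Prop := Tiles {
  tiles_size : size ts = k.+1;
  tiles_set : all (fun t => t \in [:: 7; 8; 9; 10]) ts;
  tiles_crossing : forall c, c \in V ->
    [/\ e c <= k, r c < 4 & nth 0 ts (e c) = 9 + odd (r c)];
  tiles_inj : {in V &, injective e};
  tiles_surj : forall j, j <= k -> crossb (nth 0 ts j) -> exists2 c, c \in V & e c = j }.

Lemma tiles_bend n k ts (e r : 'I_n -> nat) V t :
  tiles k ts e r V -> t \in [:: 7; 8] -> tiles k.+1 (rcons ts t) e r V.
Proof.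
case=> hs ht hc hi hj t78; split=> //.
- by rewrite size_rcons hs.
- rewrite all_rcons ht andbT; move: t78; rewrite !inE; by case/orP => ->; rewrite ?orbT.
- move=> c /hc[h1 h2 h3]; rewrite nth_rcons hs (h1 : e c < k.+1); split=> //; exact: leqW.
move=> j jk; rewrite nth_rcons hs ltnS.
move: jk; rewrite leq_eqVlt ltnS => /orP[/eqP ->|jk].
  by rewrite ltnn eqxx; move: t78; rewrite !inE => /orP[] /eqP ->.
by rewrite jk; apply: hj.
Qed.

Lemma tiles_cross n k ts (e r : 'I_n -> nat) V c0 r0 :
  tiles k ts e r V -> c0 \notin V -> r0 < 4 ->
  tiles k.+1 (rcons ts (9 + odd r0)) (fun c => if c == c0 then k.+1 else e c)
    (fun c => if c == c0 then r0 else r c) (c0 |: V).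
Proof.
case=> hs ht hc hi hj c0V r04; split=> //.
- by rewrite size_rcons hs.
- by rewrite all_rcons ht andbT; case: (odd r0).
- move=> c; rewrite in_setU1; case: eqP => [->|_] /=.
    by rewrite nth_rcons hs ltnn eqxx.
  move=> /hc[h1 h2 h3]; rewrite nth_rcons hs (h1 : e c < k.+1); split=> //; exact: leqW.
- move=> c c'; rewrite !in_setU1; case: eqP => [->|_] /=; case: eqP => [->|_] //=.
  + by move=> _ /hc[h _ _] E; move: h; rewrite -E ltnn.
  + by move=> /hc[h _ _] _ E; move: h; rewrite E ltnn.
  exact: hi.
move=> j jk; rewrite nth_rcons hs ltnS.
move: jk; rewrite leq_eqVlt ltnS => /orP[/eqP -> _|jk].
  by exists c0; rewrite ?setU11 ?eqxx.
rewrite jk => /(hj _ jk)[c cV <-]; exists c; first by rewrite setU1r.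
by case: eqP cV c0V => // -> ->.
Qed.


(** Realizes a state of [reach] by tiles: [ou] and [ov] pair each open dart with the outer side its
    strand has reached, and the strand of the focus [x] has reached the right end [(k, 0)]. *)
Record row n (al : 'I_n * 'I_4 -> 'I_n * 'I_4) k ts A (e r : 'I_n -> nat)
    (ou : seq (('I_n * 'I_4) * cport)) x ov V : Prop := Row {
  row_tiles : tiles k ts e r V;
  row_geom : exists lab c, geom k A (map snd ou) (map snd ov) lab c;
  row_vis : forall d, d \in x :: map fst (ou ++ ov) -> d.1 \in V;
  row_open : forall o, o \in (x, (k, 0)) :: ou ++ ov -> leads ts A (prt e r o.1) o.2;
  row_done : forall d, d.1 \in V -> d \notin x :: map fst (ou ++ ov) ->
    (al d).1 \in V /\ joins ts A (prt e r d) (prt e r (al d));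
  row_cover : covers ts A (fun p => exists2 d, d.1 \in V & p = prt e r d) }.

Lemma prt_slot n (e r : 'I_n -> nat) d i :
  prt e r (slot d i) = (e d.1, (d.2 + r d.1 + i) %% 4).
Proof. by rewrite /prt /slot /= val_sh modnDml addnAC. Qed.

Lemma row_start n (al : 'I_n * 'I_4 -> _) (d : 'I_n * 'I_4) : exists k ts A e r ou ov,
  [/\ row al k ts A e r ou (slot d 2) ov [set d.1],
      map fst ou = [:: slot d 1; d] & map fst ov = [:: slot d 3]].
Proof.
(* [r0] puts the slot of [d] on side 2 (W). *)
pose r0 := (6 - d.2) %% 4.
have r04 : r0 < 4 by rewrite ltn_pmod.
have dr : (d.2 + r0) %% 4 = 2 by rewrite modnDmr; have := ltn_ord d.2; lia.
have ps i : prt (fun=> 0) (fun=> r0) (slot d i) = (0, (2 + i) %% 4).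
  by rewrite prt_slot -modnDml dr.
have pd : prt (fun=> 0) (fun=> r0) d = (0, 2) by rewrite /prt dr.
exists 0, [:: 9 + odd r0], [::], (fun=> 0), (fun=> r0),
  [:: (slot d 1, (0, 3)); (d, (0, 2))], [:: (slot d 3, (0, 1))]; split=> //; split.
- split=> //.
  + by case: (odd r0).
  + by move=> c c'; rewrite !inE => /eqP -> /eqP ->.
  by move=> [|j] // _ _; exists d.1; rewrite ?inE.
- by have [lab g] := geom_start; exists lab, 4.
- by move=> z; rewrite !inE => /or4P[] /eqP ->.
- by move=> o; rewrite !inE => /or4P[] /eqP -> /=; rewrite ?ps ?pd; apply: leads_refl.
- move=> z; rewrite inE => /eqP zd; have := mem_crossing d z; rewrite zd eqxx.
  rewrite !inE !negb_or => h /and4P[h1 h2 h3 h4].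
  by move: h; rewrite (negbTE h1) (negbTE h2) (negbTE h3) (negbTE h4).
move=> [|j] s // _ s4 tl ad F C Cs Ct Cc CA.
have [d' d'd pE] : exists2 d', d'.1 = d.1 & prt (fun=> 0) (fun=> r0) d' = (0, s).
  exists (slot d (s + 2)) => //; rewrite ps; congr pair; lia.
exists (0, s); last by exists d'; rewrite ?pE // d'd inE.
have h := Cc (0, s) isT s4; exact: Ct h (Cs _ _ h).
Qed.

(** Each of the two arcs of the bend has an end glued to an older side, so no new component
    arises. *)
Lemma covers_bend ts A A' Q Q' t z y s :
  {subset A <= A'} -> (forall p, Q p -> Q' p) -> covers ts A Q ->
  (z, (size ts, 2)) \in A' -> (y, (size ts, s)) \in A' ->
  (z.1 < size ts) && (z.2 < 4) -> (y.1 < size ts) && (y.2 < 4) ->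
  (t, s) \in [:: (7, 3); (8, 1)] -> covers (rcons ts t) A' Q'.
Proof.
move=> sA QQ cv zA yA zo yo tS; apply: covers_append sA QQ cv _ => s' s'4 tl ad F C Cs Ct Cc CA.
have old p : (p.1 < size ts) && (p.2 < 4) -> C p (size ts, s') ->
    exists2 p, C (size ts, s') p &
      Q' p \/ exists j s', [/\ p = (j, s'), j < size ts & s' < 4].
  by case: p => j i /andP[/= h1 h2] h; exists (j, i); [apply: Cs | right; exists j, i].
have Cz := CA _ _ zA; have Cy := CA _ _ yA.
have Cz' := Ct _ _ _ Cz (Cc 2 isT); have Cy' : C y (size ts, through t s).
  by apply: Ct Cy (Cc s _); move: tS; rewrite !inE => /orP[] /eqP[_ ->].
move: tS Cy Cy' Cz Cz'; rewrite !inE => /orP[] /eqP[-> ->] /= Cy Cy' Cz Cz';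
  case: s' s'4 old {Cc} => [|[|[|[|//]]]] _ old;
  by [apply: old yo _ | apply: old zo _].
Qed.

Lemma geom_port k A pu pv lab c y : geom k A pu pv lab c ->
  y \in (k, 0) :: pu ++ pv -> (y.1 < k.+1) && (y.2 < 4).
Proof.
case=> gp _ _ _ _ _ _ _ h; case: y h => j s h.
rewrite -mem_cports (perm_mem gp); move: h; rewrite !inE !mem_cat.
by case/or3P => ->; rewrite ?orbT.
Qed.

(** [T7] turns the old focus up to its north side and brings the last bottom end to its east
    side. *)
Lemma row_left n (al : 'I_n * 'I_4 -> _) k ts A e r d y ou x ov V :
  row al k ts A e r ((d, y) :: ou) x ov V ->
  row al k.+1 (rcons ts 7) [:: ((k, 0), (k.+1, 2)), (y, (k.+1, 3)) & A] e r
    ou d ((x, (k.+1, 1)) :: ov) V.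
Proof.
case=> T [lab [c G]] vis op dn cv; have sz := tiles_size T.
set A' := [:: _, _ & A].
have sA : {subset A <= A'} by move=> a aA; rewrite !inE aA !orbT.
have A1 : ((k, 0), (size ts, 2)) \in A' by rewrite sz mem_head.
have A2 : (y, (size ts, 3)) \in A' by rewrite sz !inE eqxx orbT.
have memE z : (z \in d :: map fst (ou ++ (x, (k.+1, 1)) :: ov)) =
    (z \in x :: map fst (((d, y) :: ou) ++ ov)).
  by rewrite /= !map_cat !inE !mem_cat !inE; do !case: (_ \in _); do !case: (_ == _).
split.
- exact: tiles_bend.
- have [lab' [c' G']] := @geom_append k A (Some y) None (map snd ou) (map snd ov) _ _ G.
  by exists lab', c'.
- by move=> z; rewrite memE; apply: vis.
- move=> o; rewrite inE mem_cat inE => /or4P[/eqP ->|oo|/eqP ->|oo] /=; rewrite -?sz.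
  + apply: leads_bend A2 _ _ _ => //; apply: leads_mono sA _.
    by apply: (op (d, y)); rewrite !inE eqxx orbT.
  + by apply: leads_mono sA _; apply: op; rewrite !inE mem_cat oo !orbT.
  + apply: leads_bend A1 _ _ _ => //; apply: leads_mono sA _.
    by apply: (op (x, (k, 0))); rewrite mem_head.
  by apply: leads_mono sA _; apply: op; rewrite !inE mem_cat oo !orbT.
- move=> z zV; rewrite memE => zn; have [h j] := dn z zV zn.
  by split=> //; apply: joins_mono sA j.
apply: covers_bend sA _ cv A1 A2 _ _ _ => //; rewrite sz; apply: (geom_port G).
  by rewrite mem_head.
by rewrite !inE eqxx orbT.
Qed.

Lemma row_right n (al : 'I_n * 'I_4 -> _) k ts A e r d y ou x ov V :
  row al k ts A e r ou x ((d, y) :: ov) V ->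
  row al k.+1 (rcons ts 8) [:: ((k, 0), (k.+1, 2)), (y, (k.+1, 1)) & A] e r
    ((x, (k.+1, 3)) :: ou) d ov V.
Proof.
case=> T [lab [c G]] vis op dn cv; have sz := tiles_size T.
set A' := [:: _, _ & A].
have sA : {subset A <= A'} by move=> a aA; rewrite !inE aA !orbT.
have A1 : ((k, 0), (size ts, 2)) \in A' by rewrite sz mem_head.
have A2 : (y, (size ts, 1)) \in A' by rewrite sz !inE eqxx orbT.
have memE z : (z \in d :: map fst (((x, (k.+1, 3)) :: ou) ++ ov)) =
    (z \in x :: map fst (ou ++ (d, y) :: ov)).
  by rewrite /= !map_cat !inE !mem_cat !inE; do !case: (_ \in _); do !case: (_ == _).
split.
- exact: tiles_bend.
- have [lab' [c' G']] := @geom_append k A None (Some y) (map snd ou) (map snd ov) _ _ G.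
  by exists lab', c'.
- by move=> z; rewrite memE; apply: vis.
- move=> o; rewrite inE mem_cat inE -orbA => /or4P[/eqP ->|/eqP ->|oo|oo] /=; rewrite -?sz.
  + apply: leads_bend A2 _ _ _ => //; apply: leads_mono sA _.
    by apply: (op (d, y)); rewrite !inE mem_cat mem_head !orbT.
  + apply: leads_bend A1 _ _ _ => //; apply: leads_mono sA _.
    by apply: (op (x, (k, 0))); rewrite mem_head.
  + by apply: leads_mono sA _; apply: op; rewrite !inE mem_cat oo !orbT.
  by apply: leads_mono sA _; apply: op; rewrite !inE mem_cat inE oo !orbT.
- move=> z zV; rewrite memE => zn; have [h j] := dn z zV zn.
  by split=> //; apply: joins_mono sA j.
apply: covers_bend sA _ cv A1 A2 _ _ _ => //; rewrite sz; apply: (geom_port G).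
  by rewrite mem_head.
by rewrite !inE mem_cat mem_head !orbT.
Qed.

Lemma row_cap_top n (al : 'I_n * 'I_4 -> _) k ts A e r d y y' ou x ov V :
  (forall z, al (al z) = z) ->
  row al k ts A e r ((d, y) :: ou) x ((al x, y') :: ov) V ->
  row al k.+1 (rcons ts 7)
    [:: ((k, 0), (k.+1, 2)), (y, (k.+1, 3)), (y', (k.+1, 1)) & A] e r ou d ov V.
Proof.
move=> al2 [T [lab [c G]] vis op dn cv]; have sz := tiles_size T.
set A' := [:: _, _, _ & A].
have sA : {subset A <= A'} by move=> a aA; rewrite !inE aA !orbT.
have A1 : ((k, 0), (size ts, 2)) \in A' by rewrite sz mem_head.
have A2 : (y, (size ts, 3)) \in A' by rewrite sz !inE eqxx orbT.
have A3 : (y', (size ts, 1)) \in A' by rewrite sz !inE eqxx !orbT.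
have memE z : (z \in x :: map fst (((d, y) :: ou) ++ (al x, y') :: ov)) =
    [|| z == x, z == al x | z \in d :: map fst (ou ++ ov)].
  by rewrite /= !map_cat !inE !mem_cat !inE; do !case: (_ \in _); do !case: (_ == _).
split.
- exact: tiles_bend.
- have [lab' [c' G']] := @geom_append k A (Some y) (Some y') (map snd ou) (map snd ov) _ _ G.
  by exists lab', c'.
- by move=> z zm; apply: vis; rewrite memE zm !orbT.
- move=> o; rewrite inE mem_cat => /or3P[/eqP ->|oo|oo] /=; rewrite -?sz.
  + apply: leads_bend A2 _ _ _ => //; apply: leads_mono sA _.
    by apply: (op (d, y)); rewrite !inE eqxx orbT.
  + by apply: leads_mono sA _; apply: op; rewrite !inE mem_cat oo !orbT.
  by apply: leads_mono sA _; apply: op; rewrite !inE mem_cat !inE oo !orbT.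
- have L1 : leads (rcons ts 7) A' (prt e r x) (size ts, 1).
    apply: leads_bend A1 _ _ _ => //; apply: leads_mono sA _.
    by apply: (op (x, (k, 0))); rewrite mem_head.
  have L2 : leads (rcons ts 7) A' (prt e r (al x)) y'.
    apply: leads_mono sA _; apply: (op (al x, y')).
    by rewrite !inE mem_cat mem_head !orbT.
  have [J1 J2] := leads_join A3 L2 L1.
  move=> z zV zn; have [->|zx] := eqVneq z x.
    by split=> //; apply: vis; rewrite memE eqxx orbT.
  have [->|zx'] := eqVneq z (al x).
    by rewrite al2; split=> //; apply: vis; rewrite memE eqxx.
  have [|h j] := dn z zV; first by rewrite memE (negbTE zx) (negbTE zx').
  by split=> //; apply: joins_mono sA j.
apply: covers_bend sA _ cv A1 A2 _ _ _ => //; rewrite sz; apply: (geom_port G).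
  by rewrite mem_head.
by rewrite !inE eqxx orbT.
Qed.

Lemma row_cap_bottom n (al : 'I_n * 'I_4 -> _) k ts A e r d y y' ou x ov V :
  (forall z, al (al z) = z) ->
  row al k ts A e r ((al x, y') :: ou) x ((d, y) :: ov) V ->
  row al k.+1 (rcons ts 8)
    [:: ((k, 0), (k.+1, 2)), (y', (k.+1, 3)), (y, (k.+1, 1)) & A] e r ou d ov V.
Proof.
move=> al2 [T [lab [c G]] vis op dn cv]; have sz := tiles_size T.
set A' := [:: _, _, _ & A].
have sA : {subset A <= A'} by move=> a aA; rewrite !inE aA !orbT.
have A1 : ((k, 0), (size ts, 2)) \in A' by rewrite sz mem_head.
have A2 : (y, (size ts, 1)) \in A' by rewrite sz !inE eqxx !orbT.
have A3 : (y', (size ts, 3)) \in A' by rewrite sz !inE eqxx !orbT.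
have memE z : (z \in x :: map fst (((al x, y') :: ou) ++ (d, y) :: ov)) =
    [|| z == x, z == al x | z \in d :: map fst (ou ++ ov)].
  by rewrite /= !map_cat !inE !mem_cat !inE; do !case: (_ \in _); do !case: (_ == _).
split.
- exact: tiles_bend.
- have [lab' [c' G']] := @geom_append k A (Some y') (Some y) (map snd ou) (map snd ov) _ _ G.
  by exists lab', c'.
- by move=> z zm; apply: vis; rewrite memE zm !orbT.
- move=> o; rewrite inE mem_cat => /or3P[/eqP ->|oo|oo] /=; rewrite -?sz.
  + apply: leads_bend A2 _ _ _ => //; apply: leads_mono sA _.
    by apply: (op (d, y)); rewrite !inE mem_cat mem_head !orbT.
  + by apply: leads_mono sA _; apply: op; rewrite !inE mem_cat oo !orbT.
  by apply: leads_mono sA _; apply: op; rewrite !inE mem_cat !inE oo !orbT.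
- have L1 : leads (rcons ts 8) A' (prt e r x) (size ts, 3).
    apply: leads_bend A1 _ _ _ => //; apply: leads_mono sA _.
    by apply: (op (x, (k, 0))); rewrite mem_head.
  have L2 : leads (rcons ts 8) A' (prt e r (al x)) y'.
    apply: leads_mono sA _; apply: (op (al x, y')).
    by rewrite !inE eqxx orbT.
  have [J1 J2] := leads_join A3 L2 L1.
  move=> z zV zn; have [->|zx] := eqVneq z x.
    by split=> //; apply: vis; rewrite memE eqxx orbT.
  have [->|zx'] := eqVneq z (al x).
    by rewrite al2; split=> //; apply: vis; rewrite memE eqxx.
  have [|h j] := dn z zV; first by rewrite memE (negbTE zx) (negbTE zx').
  by split=> //; apply: joins_mono sA j.
apply: covers_bend sA _ cv A1 A2 _ _ _ => //; rewrite sz; apply: (geom_port G).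
  by rewrite mem_head.
by rewrite !inE mem_cat mem_head !orbT.
Qed.

Lemma row_cross n (al : 'I_n * 'I_4 -> _) k ts A e r ou x ov V :
  (forall z, al (al z) = z) ->
  row al k ts A e r ou x ov V -> let d := al x in d.1 \notin V ->
  exists t e' r', row al k.+1 (rcons ts t) (((k, 0), (k.+1, 2)) :: A) e' r'
    ((slot d 1, (k.+1, 3)) :: ou) (slot d 2) ((slot d 3, (k.+1, 1)) :: ov) (d.1 |: V).
Proof.
move=> al2 [T [lab [c G]] vis op dn cv] d dV; have sz := tiles_size T.
(* The turn that puts [d] on the west side 2, against the focus; 6 replaces 2 to keep the
   subtraction from truncating. *)
pose r0 := (6 - d.2) %% 4.
have r04 : r0 < 4 by rewrite ltn_pmod.
have dr : (d.2 + r0) %% 4 = 2 by rewrite modnDmr; have := ltn_ord d.2; lia.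
pose e' c := if c == d.1 then k.+1 else e c.
pose r' c := if c == d.1 then r0 else r c.
exists (9 + odd r0), e', r'.
have ps i : prt e' r' (slot d i) = (k.+1, (2 + i) %% 4).
  by rewrite prt_slot /e' /r' eqxx -modnDml dr.
have pd : prt e' r' d = (k.+1, 2) by rewrite /prt /e' /r' eqxx dr.
have pV z : z.1 \in V -> prt e' r' z = prt e r z.
  by move=> zV; rewrite /prt /e' /r'; case: eqP zV dV => // -> ->.
set A' := _ :: A.
have sA : {subset A <= A'} by move=> a aA; rewrite !inE aA !orbT.
have A1 : ((k, 0), (size ts, 2)) \in A' by rewrite sz mem_head.
set ou' := _ :: ou; set ov' := _ :: ov.
have memE z : (z \in d :: slot d 2 :: map fst (ou' ++ ov')) =
    (z.1 == d.1) || (z \in map fst (ou ++ ov)).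
  rewrite -mem_crossing /= !map_cat !inE !mem_cat !inE.
  by do !case: (_ \in _); do !case: (_ == _).
have opV o : o \in ou ++ ov -> o.1.1 \in V.
  by move=> oo; apply: vis; rewrite inE map_f // orbT.
have xV : x.1 \in V by apply: vis; rewrite mem_head.
have Lx : leads (rcons ts (9 + odd r0)) A' (prt e' r' x) (k, 0).
  rewrite pV //; apply: leads_mono sA _.
  by apply: (op (x, (k, 0))); rewrite mem_head.
split.
- exact: tiles_cross.
- have [lab' [c' G']] := @geom_append k A None None (map snd ou) (map snd ov) _ _ G.
  by exists lab', c'.
- move=> z zm; have := memE z; rewrite inE zm orbT => /esym.
  rewrite in_setU1 => /orP[->//|zm']; rewrite (vis z) ?orbT //.
  by rewrite inE zm' orbT.
- move=> o om.
  have : [|| o == (slot d 2, (k.+1, 0)), o == (slot d 1, (k.+1, 3)),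
             o == (slot d 3, (k.+1, 1)) | o \in ou ++ ov].
    by move: om; rewrite !inE !mem_cat !inE; do !case: (_ \in _); do !case: (_ == _).
  case/or4P => [/eqP ->|/eqP ->|/eqP ->|oo]; rewrite ?ps; [exact: leads_refl..|].
  by rewrite pV ?opV //; apply: leads_mono sA _; apply: op; rewrite inE oo orbT.
- have [J1 J2] : joins (rcons ts (9 + odd r0)) A' (prt e' r' x) (prt e' r' d) /\
      joins (rcons ts (9 + odd r0)) A' (prt e' r' d) (prt e' r' x).
    by apply: leads_join Lx _; [exact: A1 | rewrite pd sz; apply: leads_refl].
  move=> z zV zn; have [->|zd] := eqVneq z d.
    by rewrite al2; split=> //; rewrite setU1r.
  have [->|zx] := eqVneq z x; first by rewrite setU11.
  have := memE z; rewrite inE (negbTE zd) (negbTE zn) => /esym/negbT.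
  rewrite negb_or => /andP[zd1 zm].
  have {}zV : z.1 \in V by move: zV; rewrite in_setU1 (negbTE zd1).
  have [|azV j] := dn z zV; first by rewrite inE (negbTE zx).
  by rewrite setU1r // !pV //; split=> //; apply: joins_mono sA j.
apply: covers_append sA _ cv _.
  move=> p [z zV ->]; exists z; first by rewrite setU1r.
  by rewrite pV.
move=> s s4 tl ad F C Cs Ct Cc CA.
exists (size ts, s); first by have h := Cc s s4; apply: Ct h (Cs _ _ h).
left; exists (slot d (s + 2)); first by rewrite setU11.
by rewrite ps sz; congr pair; lia.
Qed.

Lemma reach_row n (al : 'I_n * 'I_4 -> _) u x v V :
  (forall z, al (al z) = z) -> reach al u x v V ->
  exists k ts A e r ou ov,
    [/\ row al k ts A e r ou x ov V, map fst ou = u & map fst ov = v].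
Proof.
move=> al2; elim=> {u x v V}.
- by move=> d; apply: row_start.
- move=> d u x v V _ [k [ts [A [e [r [[|[d' y] ou] [ov [R //= [E1 E2] E3]]]]]]]].
  rewrite E1 in R; have R' := row_left R.
  by do 7!eexists; split; [exact: R' | | rewrite /= E3].
- move=> d u x v V _ [k [ts [A [e [r [ou [[|[d' y] ov] [R E1 //= [E2 E3]]]]]]]]].
  rewrite E2 in R; have R' := row_right R.
  by do 7!eexists; split; [exact: R' | rewrite /= E1 |].
- move=> u x v V _ [k [ts [A [e [r [ou [ov [R E1 E2]]]]]]]] dV.
  have [t [e' [r' R']]] := row_cross al2 R dV.
  by do 7!eexists; split; [exact: R' | rewrite /= E1 | rewrite /= E2].
- move=> d u x v V _ [k [ts [A [e [r [[|[d' y] ou] [[|[d2 y'] ov] [R //= [E1 E2] // [E3 E4]]]]]]]]].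
  rewrite E1 E3 in R; have R' := row_cap_top al2 R.
  by do 7!eexists; split; [exact: R' | |].
move=> d u x v V _ [k [ts [A [e [r [[|[d' y'] ou] [[|[d2 y] ov] [R //= [E1 E2] // [E3 E4]]]]]]]]].
rewrite E1 E3 in R; have R' := row_cap_bottom al2 R.
by do 7!eexists; split; [exact: R' | |].
Qed.

(** * The closed row *)

Fixpoint partner (A : seq (cport * cport)) (y : cport) : cport :=
  if A is a :: A' then
    if y == a.1 then a.2 else if y == a.2 then a.1 else partner A' y
  else y.

Lemma partner_mem A y y' : uniq (unpair A) -> (y, y') \in A ->
  partner A y = y' /\ partner A y' = y.
Proof.
elim: A => //= [[a b] A IH] /=; rewrite inE negb_or => /and3P[/andP[nab aA] bA uA].
rewrite inE => /orP[/eqP[-> ->]|yA]; first by rewrite !eqxx eq_sym (negbTE nab).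
have [h1 h2] := mem_unpair yA.
have nm z w : z \in unpair A -> w \notin unpair A -> (z == w) = false.
  by move=> h /negP h'; apply/eqP => zw; apply: h'; rewrite -zw.
by rewrite !(nm y) // !(nm y') //; apply: IH.
Qed.

Lemma unpair_mem A y : y \in unpair A ->
  exists y', (y, y') \in A \/ (y', y) \in A.
Proof.
elim: A => //= [[a b] A IH]; rewrite !inE => /or3P[/eqP ->|/eqP ->|/IH[y' h]].
- by exists b; left; rewrite inE eqxx.
- by exists a; right; rewrite inE eqxx.
by exists y'; rewrite !inE; case: h => ->; rewrite orbT; [left|right].
Qed.

Lemma partner_ne A y : uniq (unpair A) -> y \in unpair A -> partner A y != y.
Proof.
elim: A => //= [[a b] A IH] /=; rewrite inE negb_or => /and3P[/andP[nab aA] bA uA].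
rewrite !inE; case: eqP => [-> _|_] /=; first by rewrite eq_sym.
by case: eqP => [-> _|_] //=; apply: IH.
Qed.

Definition border k y := outer y || (y == (k, 0)).

(** Here [A] matches all sides of all tiles, inner walls included, so that one involution describes
    every adjacency. *)
Record glued_row k ts A (lab : cport -> nat) : Prop := GluedRow {
  closed_size : size ts = k.+1;
  closed_set : all (fun t => t \in [:: 7; 8; 9; 10]) ts;
  closed_perm : perm_eq (cports k.+1) (unpair A);
  closed_wall : forall j, j < k -> ((j, 0), (j.+1, 2)) \in A;
  closed_border : forall a, a \in A ->
    (exists2 j, j < k & a = ((j, 0), (j.+1, 2))) \/ border k a.1 && border k a.2;
  closed_lab : forall l, l < k.+2 -> exists r q, [/\ r < 2, q <= k.+1 & lab (r, q) = l];
  closed_glue : forall y y', (y, y') \in A ->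
    lab (point0 y) = lab (point1 y') /\ lab (point1 y) = lab (point0 y') }.

Notation port1 k := ('I_1 * 'I_k.+1 * 'I_4)%type.

Definition code k (p : port1 k) : cport := (val p.1.2, val p.2).
Definition uncode k (y : cport) : port1 k := (ord0, inord y.1, inord y.2).

Lemma code_cports k (p : port1 k) : code p \in cports k.+1.
Proof. by rewrite mem_cports !ltn_ord. Qed.

Lemma codeK k : cancel (@code k) (@uncode k).
Proof. by case=> [[i j] s]; rewrite /uncode /code !inord_val (ord1 i). Qed.

Lemma uncodeK k y : y \in cports k.+1 -> code (uncode k y) = y.
Proof.
by case: y => j s; rewrite mem_cports => /andP[h1 h2]; rewrite /code /= !inordK.
Qed.

Definition row_mosaic k ts A : vmosaic 1 k.+1 :=
  VM [ffun x : 'I_1 * 'I_k.+1 => inord (nth 0 ts x.2) : tile]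
     [ffun p : port1 k => uncode k (partner A (code p))].

Lemma glued_uniq k ts A lab : glued_row k ts A lab -> uniq (unpair A).
Proof. by case=> _ _ /perm_uniq <- _ _ _ _; apply: cports_uniq. Qed.

Lemma glued_fits k ts A lab : glued_row k ts A lab -> fits ts A (nth 0 ts) (partner A).
Proof.
move=> H; split=> // y y' yA; exact: partner_mem (glued_uniq H) yA.
Qed.

Lemma glued_partner k ts A lab y : glued_row k ts A lab -> y \in cports k.+1 ->
  [/\ partner A y \in cports k.+1, partner A (partner A y) = y, partner A y != y,
    lab (point0 y) = lab (point1 (partner A y)) /\
    lab (point1 y) = lab (point0 (partner A y)) &
    border k y -> border k (partner A y)].
Proof.
move=> H; have U := glued_uniq H.
rewrite (perm_mem (closed_perm H)) => yA; have ne := partner_ne U yA.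
have [y' [h|h]] := unpair_mem yA; have [e1 e2] := partner_mem U h;
  have [m1 m2] := mem_unpair h; have [g1 g2] := closed_glue H h;
  have cb := closed_border H h; rewrite (perm_mem (closed_perm H)).
- rewrite e1 in ne *; split=> // bd; case: cb => [[j jk [yE _]]|/andP[] //].
  by move: bd; rewrite yE /border /outer !xpair_eqE /=; lia.
rewrite e2 in ne *; split=> // bd; case: cb => [[j jk [_ yE]]|/andP[] //].
by move: bd; rewrite yE /border /outer !xpair_eqE /=; lia.
Qed.

Lemma is_bd_code k (p : port1 k) : is_bd p = border k (code p).
Proof.
case: p => [[i j] s]; rewrite (ord1 i) /is_bd /border /outer /code /= !xpair_eqE.
by rewrite !andbT; do !case: (_ == _); rewrite ?orbT.
Qed.

(** Boundary sides agree by the definition of [bpair], inner ones because the walls between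
    neighbouring tiles belong to [A]. *)
Lemma adj_code k ts A lab (p : port1 k) : glued_row k ts A lab ->
  code (adj (row_mosaic k ts A) p) = partner A (code p).
Proof.
move=> H; rewrite /adj; case: ifP => [_|].
  rewrite ffunE uncodeK //.
  by have [] := glued_partner H (code_cports p).
rewrite is_bd_code; case: p => [[i j] [s s4]] => bd.
have F := (glued_fits H).2.
have jk := ltn_ord j.
move: bd; rewrite /border /outer /code !xpair_eqE /= /nb.
case: s s4 => [|[|[|[|//]]]] s4 //= bd; try by move: bd; lia.
  have jk' : j < k by move: bd jk; lia.
  have [-> _] := F _ _ (closed_wall H jk').
  by rewrite /= inordK // val_insubd ltnS jk'.
have j0 : 0 < j by move: bd; lia.
have jk' : j.-1 < k by lia.
have [_] := F _ _ (closed_wall H jk').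
rewrite (prednK j0) => -> /=; rewrite inordK // val_insubd.
by rewrite (leq_ltn_trans (leq_pred _)).
Qed.

Lemma glued_tile k ts A lab (j : 'I_k.+1) : glued_row k ts A lab ->
  nth 0 ts j \in [:: 7; 8; 9; 10] /\ forall i, mtile (row_mosaic k ts A) (i, j) = nth 0 ts j :> nat.
Proof.
move=> H; have t : nth 0 ts j \in [:: 7; 8; 9; 10].
  by apply: (allP (closed_set H)); rewrite mem_nth // (closed_size H).
split=> // i; rewrite ffunE inordK //=.
by move: t; rewrite !inE => /or4P[] /eqP ->.
Qed.

Lemma glued_conn k ts A lab (p : port1 k) : glued_row k ts A lab ->
  let M := row_mosaic k ts A in
  [/\ conn (mtile M p.1) p.2 = Some (inord (through (nth 0 ts (code p).1) (code p).2)),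
      through (nth 0 ts (code p).1) (code p).2 < 4 &
      is_cross (mtile M p.1) = crossb (nth 0 ts (code p).1)].
Proof.
move=> H M; case: p => [[i j] [s s4]] /=.
have [t tE] := glued_tile j H; rewrite /is_cross /conn tE /code /through /=.
by move: t s4; rewrite !inE => /or4P[] /eqP ->; case: s => [|[|[|[|//]]]].
Qed.

Lemma glued_active k ts A lab (p : port1 k) : glued_row k ts A lab ->
  active (mtile (row_mosaic k ts A) p.1) p.2.
Proof. by move=> H; rewrite /active; have [-> _ _] := glued_conn p H. Qed.

Lemma glued_valid k ts A lab : glued_row k ts A lab -> valid_vmosaic (row_mosaic k ts A).
Proof.
move=> H; split=> // p; last by rewrite !(glued_active _ H).
rewrite is_bd_code => bd; have := adj_code p H; rewrite /adj is_bd_code bd => bE.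
have [h1 h2 h3 _ h5] := glued_partner H (code_cports p).
rewrite is_bd_code bE h5 //; split=> //.
  by apply: (can_inj (@codeK k)); rewrite ffunE uncodeK bE h2 ?code_cports.
by apply: contraNneq h3 => e; rewrite -bE e.
Qed.

(** A labelling constant on glued points factors through the vertex classes. *)
Lemma nvert_lower m n (M : vmosaic m n) (lab : 'I_m.+1 * 'I_n.+1 -> nat) c :
  (forall x y, vrel M x y -> lab x = lab y) ->
  (forall l, l < c -> exists2 x, bpoint x & lab x = l) -> c <= nvert M.
Proof.
move=> hv hl; case: c hl => // c hl.
pose cl x := [set y | connect (vrel M) x y].
pose f (S : {set 'I_m.+1 * 'I_n.+1}) : 'I_c.+1 :=
  inord (if [pick x in S] is Some x then lab x else 0).
have labc x y : connect (vrel M) x y -> lab x = lab y.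
  case/connectP => s; elim: s x => [x _ -> //|z s IH] x /= /andP[/hv -> ps] e.
  exact: IH.
have fcl x : f (cl x) = inord (lab x).
  rewrite /f; case: pickP => [y|/(_ x)]; rewrite inE; first by move/labc ->.
  by rewrite connect0.
rewrite /nvert; set S := imset _ _.
apply: leq_trans (leq_imset_card f S); rewrite -[X in X <= _]card_ord -cardsT.
apply/subset_leq_card/subsetP => l _; have [x bx lx] := hl l (ltn_ord l).
apply/imsetP; exists (cl x); first by apply/imsetP; exists x; rewrite ?inE.
by rewrite fcl lx inord_val.
Qed.

Lemma glued_genus k ts A lab : glued_row k ts A lab -> mgenus (row_mosaic k ts A) = 0.
Proof.
move=> H; pose lab' (x : 'I_2 * 'I_k.+2) := lab (val x.1, val x.2).
have pt0 p : is_bd p -> lab' (bstart p) = lab (point0 (@code k p)).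
  rewrite is_bd_code; case: p => [[i j] [s s4]].
  rewrite (ord1 i) /lab' /border /outer /code !xpair_eqE /=; have := ltn_ord j.
  case: s s4 => [|[|[|[|//]]]] s4 /= jk bd; rewrite /point0 /= ?inordK //; try lia.
    by congr (lab (_, _)); lia.
  by congr (lab (_, _)); lia.
have pt1 p : is_bd p -> lab' (bend p) = lab (point1 (@code k p)).
  rewrite is_bd_code; case: p => [[i j] [s s4]].
  rewrite (ord1 i) /lab' /border /outer /code !xpair_eqE /=; have := ltn_ord j.
  case: s s4 => [|[|[|[|//]]]] s4 /= jk bd; rewrite /point1 /= ?inordK //; try lia.
    by congr (lab (_, _)); lia.
  by congr (lab (_, _)); lia.
have [_ _ V _] := glued_valid H.
have : k.+2 <= nvert (row_mosaic k ts A).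
  apply: (@nvert_lower _ _ _ lab').
    move=> x y /existsP[p /andP[bd]]; have [bd' _ _] := V p bd.
    have [_ _ _ [g0 g1] _] := glued_partner H (code_cports p).
    have := adj_code p H; rewrite /adj bd => bE.
    case/orP => /andP[/eqP <- /eqP <-]; rewrite pt0 // pt1 // bE //.
  move=> l lk; have [r [q [r2 qk <-]]] := closed_lab H lk.
  exists (inord r, inord q); last by rewrite /lab' /= !inordK.
  by rewrite /bpoint /= inordK //; case: r r2 => [|[|]].
(* Here [1 + m + n] is [k + 3], so [k + 2] classes leave at most 1, which halves to 0. *)
by rewrite /mgenus; case: (nvert _) => [|v]; lia.
Qed.

(** A fixed point on the orbit of [x] is met within [#|T|] steps, so the fixed iteration count in
    [mtrace] is large enough. *)
Lemma iter_absorb (T : finType) (f : T -> T) x q i m :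
  f q = q -> iter i f x = q -> #|T| <= m -> iter m f x = q.
Proof.
move=> fq iq Tm; have c : fconnect f x q by rewrite -iq fconnect_iter.
have jm : findex f x q <= m.
  by apply: leq_trans (ltnW (findex_max c)) (leq_trans (max_card _) Tm).
rewrite -(subnK jm) iterD iter_findex //.
by elim: (m - _) => //= l ->.
Qed.

(** * Strands and connectedness of the closed row *)

Lemma mrel_sym k ts A lab : glued_row k ts A lab -> symmetric (mrel (row_mosaic k ts A)).
Proof.
move=> H; set M := row_mosaic k ts A.
suff h p q : mrel M p q -> mrel M q p by move=> p q; apply/idP/idP; apply: h.
rewrite /mrel !(glued_active _ H) /= => /orP[/andP[/eqP e /eqP cq]|/eqP aq].
  rewrite e eqxx /= -e; have [cp _ _] := glued_conn p H; have [cq' _ _] := glued_conn q H.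
  have : Some (inord (through (nth 0 ts (code p).1) (code p).2)) = Some q.2 by rewrite -cp.
  have E : (code p).1 = (code q).1 by rewrite /code e.
  rewrite e cq' E => -[sE]; apply/orP; left; apply/eqP; congr Some.
  have [t _] := glued_tile (q.1.2) H.
  move: sE t; rewrite /code /=; case: (p.2) => s s4; rewrite !inE => <-.
  case/or4P => /eqP ->; case: s s4 => [|[|[|[|//]]]] s4; apply: val_inj;
    by rewrite /through /= !inordK.
apply/orP; right; apply/eqP/(can_inj (@codeK k)); rewrite -aq !(adj_code _ H).
by have [] := glued_partner H (code_cports p).
Qed.

Lemma connect_adj k ts A lab (p : port1 k) : glued_row k ts A lab ->
  connect (mrel (row_mosaic k ts A)) p (adj (row_mosaic k ts A) p).
Proof. by move=> H; rewrite connect1 // /mrel (glued_active _ H) eqxx orbT. Qed.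

Lemma connect_through k ts A lab (p : port1 k) : glued_row k ts A lab ->
  connect (mrel (row_mosaic k ts A)) p
    (p.1, inord (through (nth 0 ts (code p).1) (code p).2)).
Proof.
move=> H; rewrite connect1 // /mrel (glued_active _ H) /= eqxx /=.
by have [-> _ _] := glued_conn p H; rewrite eqxx.
Qed.

Lemma glued_trace k ts A lab (p q : port1 k) i : glued_row k ts A lab ->
  iter i (step (nth 0 ts) (partner A)) (partner A (code p)) = code q ->
  crossb (nth 0 ts (code q).1) ->
  mtrace (row_mosaic k ts A) p = q /\ connect (mrel (row_mosaic k ts A)) p q.
Proof.
move=> H; set M := row_mosaic k ts A => iE cq.
pose g q := if is_cross (mtile M q.1) then q
            else adj M (q.1, odflt q.2 (conn (mtile M q.1) q.2)).
have gE z : g z = if crossb (nth 0 ts (code z).1) then z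
    else adj M (z.1, inord (through (nth 0 ts (code z).1) (code z).2)).
  by rewrite /g; have [-> _ ->] := glued_conn z H.
have gcode z : code (g z) = step (nth 0 ts) (partner A) (code z).
  rewrite gE /step; case: ifP => // _; rewrite (adj_code _ H).
  by have [_ t4 _] := glued_conn z H; congr (partner A (_, _)); rewrite /code /= inordK.
have gi j z : code (iter j g z) = iter j (step (nth 0 ts) (partner A)) (code z).
  by elim: j => //= j <-.
have giq : iter i g (adj M p) = q.
  by apply: (can_inj (@codeK k)); rewrite gi (adj_code _ H).
split.
  rewrite /mtrace -/g; apply: iter_absorb giq _; first by rewrite gE cq.
  by rewrite !card_prod !card_ord.
rewrite -giq; elim: (i) => [|j IH] /=; first exact: connect_adj H.
apply: connect_trans IH _; rewrite gE; case: ifP => // _.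
exact: connect_trans (connect_through _ H) (connect_adj _ H).
Qed.

Lemma glued_knot k ts A lab (S : port1 k -> Prop) : glued_row k ts A lab ->
  let M := row_mosaic k ts A in
  (forall p, exists2 q, connect (mrel M) p q & S q) ->
  (forall p q, S p -> S q -> connect (mrel M) p q) -> knot_mosaic M.
Proof.
move=> H M cS SS; apply/andP; split.
  by apply/existsP; exists (ord0, ord0, ord0); apply: glued_active H.
apply/forallP => p; apply/forallP => q; apply/implyP => _; apply/implyP => _.
have [p' pp' Sp] := cS p; have [q' qq' Sq] := cS q.
have sym := sym_connect_sym (mrel_sym H).
apply: connect_trans pp' _; apply: connect_trans (SS _ _ Sp Sq) _.
by rewrite sym.
Qed.

(** * Half turns of crossing labels *)

Definition halfturn n (s : 'I_n -> bool) (d : 'I_n * 'I_4) : 'I_n * 'I_4 :=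
  slot d (2 * s d.1).

Lemma halfturnK n (s : 'I_n -> bool) : involutive (halfturn s).
Proof.
move=> [c i]; rewrite /halfturn /slot /= sh_sh; case: (s c); rewrite ?sh4 //.
by congr pair; apply: val_inj; rewrite /= val_sh addn0 modn_small.
Qed.

Lemma halfturn_slot n (s : 'I_n -> bool) d k :
  halfturn s (slot d k) = slot (halfturn s d) k.
Proof. by rewrite /halfturn /slot /= !sh_sh addnC. Qed.

Definition relabel (D : pd) (s : 'I_(nc D) -> bool) : pd :=
  @PD (nc D) [ffun d => halfturn s (lnk D (halfturn s d))].

Lemma relabel_lnk D s (d : dart D) :
  halfturn s (lnk (relabel s) d) = lnk D (halfturn s d).
Proof. by rewrite ffunE halfturnK. Qed.

Lemma relabel_iso D s : pd_iso (@relabel D s) D.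
Proof.
exists id, s; split=> [|d]; first by exists id.
by rewrite -[LHS]/(lnk D (halfturn s d)) -relabel_lnk.
Qed.

(** Half turns commute with [rot] and [straight], so they conjugate the strand and face
    permutations. *)
Lemma relabel_sphere D s : sphere_knot D -> sphere_knot (@relabel D s).
Proof.
case=> [h|[V c f]]; [by left | right].
have hb : bijective (halfturn s) by exists (halfturn s); apply: halfturnK.
split.
- move=> d; have [V1 V2] := V (halfturn s d).
  split; first by rewrite /= !ffunE halfturnK V1 halfturnK.
  by move=> e; apply: V2; rewrite -relabel_lnk e.
- rewrite -c; apply: (@norbits_conj _ _ _ _ (halfturn s) hb) => d.
  by rewrite -[straight _]/(slot _ 2) halfturn_slot relabel_lnk.
rewrite -[nc _]/(nc D) -f; apply: (@norbits_conj _ _ _ _ (halfturn s) hb) => d.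
by rewrite -[Defs.rot _]/(slot _ 1) halfturn_slot relabel_lnk.
Qed.

Lemma relabel_equiv D s : sphere_knot D -> knot_equiv (@relabel D s) D.
Proof.
move=> h; apply: rst_step; split; first exact: relabel_sphere.
by split=> //; apply: Or41; apply: relabel_iso.
Qed.

(** A single [T7] with west glued to south and east to north: its two arcs close up to one
    circle. *)
Lemma unknot_glued_row : exists lab,
  glued_row 0 [:: 7] [:: ((0, 2), (0, 3)); ((0, 0), (0, 1))] lab.
Proof.
(* The glued corners [(0, 0)] and [(1, 1)] get label 0, the other two corners 1 and 2. *)
exists (fun p => p.1 + 2 * p.2 - 3 * (p.1 * p.2)); split=> //.
- by move=> a; rewrite !inE => /orP[] /eqP ->; right.
- by move=> [|[|//]] _; [exists 0, 0 | exists 1, 0].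
by move=> y y'; rewrite !inE => /orP[] /eqP[-> ->].
Qed.

(** The last two open sides form a closed chain of length two, so their ends already carry matching
    labels and the final gluing costs none. *)
Lemma geom_glued_row k ts A y lab c : geom k A [:: y] [::] lab c ->
  size ts = k.+1 -> all (fun t => t \in [:: 7; 8; 9; 10]) ts ->
  glued_row k ts (((k, 0), y) :: A) lab.
Proof.
case=> gp gw go gop gl gg [a [c1 [c2 c3]]] gn hs ht; split=> //.
- by move=> j jk; rewrite inE gw ?orbT.
- move=> b; rewrite inE => /orP[/eqP ->|bA].
    by right; rewrite /border eqxx orbT /=; move: gop; rewrite /= andbT => ->.
  case: (go b bA) => [[j bE]|/andP[h1 h2]]; last by right; rewrite /border h1 h2.
  left; exists j => //; rewrite bE in bA; have [_] := mem_unpair bA.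
  have := perm_mem gp (j.+1, 2); rewrite mem_cports !inE /= => E h.
  by move: E; rewrite h !orbT andbT ltnS.
- by move=> l lk; apply: gl; move: gn => /=; lia.
move=> z z'; rewrite inE => /orP[/eqP[-> ->]|]; last exact: gg.
by rewrite c2 c3 c1.
Qed.

Lemma row_joins n (al : 'I_n * 'I_4 -> _) k ts A e r x y :
  (forall z, al (al z) = z) ->
  row al k ts A e r [:: (al x, y)] x [::] setT ->
  forall d, joins ts (((k, 0), y) :: A) (prt e r d) (prt e r (al d)).
Proof.
move=> al2 [_ _ _ op dn _] d; set A' := _ :: A.
have sub tl ad : fits ts A' tl ad -> fits ts A tl ad.
  by case=> h1 h2; split=> // z z' h; apply: h2; rewrite inE h orbT.
have [J1 J2] : joins ts A' (prt e r x) (prt e r (al x)) /\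
    joins ts A' (prt e r (al x)) (prt e r x).
  apply: (@leads_join ts A' _ (k, 0) _ y); first exact: mem_head.
    by move=> tl ad /sub; apply: (op (x, (k, 0))); rewrite inE eqxx.
  by move=> tl ad /sub; apply: (op (al x, y)); rewrite !inE eqxx orbT.
have [->|dx] := eqVneq d x; first exact: J1.
have [->|dx'] := eqVneq d (al x); first by rewrite al2; exact: J2.
have [||_ j tl ad /sub] := dn d; [by rewrite inE | | exact: j].
by rewrite !inE (negbTE dx) (negbTE dx').
Qed.

Lemma unknot_row D : nc D = 0 -> exists (n : nat) (M : vmosaic 1 n),
  [/\ valid_vmosaic M, knot_mosaic M, mgenus M = 0 & mosaic_pd M D].
Proof.
move=> D0; have no (c : 'I_(nc D)) : False by have := ltn_ord c; rewrite {2}D0.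
have [lab H] := unknot_glued_row; set A := [:: _; _] in H.
exists 1, (row_mosaic 0 [:: 7] A); split.
- exact: glued_valid H.
- apply: (@glued_knot _ _ _ _ (fun p => p = uncode 0 (0, 0)) H); last first.
    by move=> p q -> ->.
  move=> p; exists (uncode 0 (0, 0)) => //.
  have th s t : s < 4 -> t < 4 -> through 7 s = t ->
      connect (mrel (row_mosaic 0 [:: 7] A)) (uncode 0 (0, s)) (uncode 0 (0, t)).
    move=> s4 t4 e; have := connect_through (uncode 0 (0, s)) H.
    by rewrite uncodeK ?mem_cports // -e.
  have c10 : connect (mrel (row_mosaic 0 [:: 7] A)) (uncode 0 (0, 1)) (uncode 0 (0, 0)).
    have := connect_adj (uncode 0 (0, 1)) H; congr connect.
    by apply: (can_inj (@codeK 0)); rewrite (adj_code _ H) !uncodeK.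
  rewrite -[p]codeK; case: p => [[i j] [s s4]]; rewrite /code /= (ord1 j).
  case: s s4 => [|[|[|[|//]]]] _ //; last exact: th.
  by apply: connect_trans c10; apply: th.
- exact: glued_genus H.
exists (fun=> (ord0, ord0)); split.
- by move=> c; case: (no c).
- by move=> c; case: (no c).
- move=> [i j]; have [_ _] := glued_conn (i, j, ord0) H.
  by rewrite /code /= (ord1 j) => ->.
by move=> [c i]; case: (no c).
Qed.

Theorem mainTheorem4 (D0 : pd) :
  sphere_knot D0 ->
  exists (n : nat) (M : vmosaic 1 n) (D : pd),
    [/\ valid_vmosaic M, knot_mosaic M, mgenus M = 0, mosaic_pd M D
      & knot_equiv D D0].
Proof.
move=> sk; have [n0|npos] := posnP (nc D0).
  have [n [M [h1 h2 h3 h4]]] := unknot_row n0.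
  by exists n, M, D0; split=> //; apply: rst_refl.
have [n0|[Vd comp faces]] := sk; first by rewrite n0 in npos.
have lnk2 : involutive (lnk D0) by move=> d; case: (Vd d).
have lnkn d : lnk D0 d != d by apply/eqP; case: (Vd d).
pose al := perm (inv_inj lnk2).
have alE d : al d = lnk D0 d by rewrite permE.
have al2 d : al (al d) = d by rewrite !alE lnk2.
have aln d : al d != d by rewrite alE.
have rt_inj : injective (fun d : dart D0 => slot d 1).
  by move=> [c i] [c' i'] [-> /sh_inj ->].
pose rt := perm rt_inj.
have rtE d : rt d = slot d 1 by rewrite permE.
pose st (d : dart D0) := slot d 2.
have cov : forall x y, fconnect (fun z => st (al z)) x y \/
               fconnect (fun z => st (al z)) (al x) y.
  apply: strand_cover => //.
  - by case=> c i; rewrite /st /slot /= sh_sh sh4.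
  - by case=> c i; rewrite /st /slot xpair_eqE /= eqxx sh_neq.
  apply: etrans comp; apply: (@norbits_conj _ _ _ _ id) => [|d]; first by exists id.
  by rewrite alE.
have cF : #|porbits (al * rt)%g| = nc D0 + 2.
  by rewrite -faces; apply/esym/norbits_perm => d; rewrite permM alE rtE.
pose d0 : dart D0 := (Ordinal npos, ord0).
have [x rx] := reach_complete al2 aln rtE (fun _ => erefl) cov (ReachStart al d0)
  (tour_start d0 rtE cF).
have [k [ts [A [e [r [ou [ov [R E1 E2]]]]]]]] := reach_row al2 rx.
case: ou E1 R => [|[x' y] [|? ?]] //= [->]; case: ov E2 => // _ R.
have [T [lab [c G]] _ _ _ cv] := R; have J := row_joins al2 R.
have [Ts Tset Tc Ti Tj] := T.
have H := geom_glued_row G Ts Tset.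
set A' := _ :: A in H J; set M := row_mosaic k ts A'.
have F := glued_fits H.
have FA : fits ts A (nth 0 ts) (partner A').
  by case: F => h1 h2; split=> // z z' h; apply: h2; rewrite inE h orbT.
pose port d := uncode k (prt e r d).
have ek c' : e c' < k.+1 by have [] := Tc c' (in_setT _).
have portK d : code (port d) = prt e r d.
  by rewrite uncodeK // mem_cports ek ltn_pmod.
have cross d : crossb (nth 0 ts (prt e r d).1).
  by have [_ _ /= ->] := Tc d.1 (in_setT _); case: (odd _).
have tr d : mtrace M (port d) = port (al d) /\ connect (mrel M) (port d) (port (al d)).
  have [i iE] := J d _ _ F.
  by apply: (@glued_trace _ _ _ _ _ _ i H); rewrite !portK.
have sym := sym_connect_sym (mrel_sym H).
(* [slot_side] realizes only the turns 0 and 1; a half turn of the labels reduces the turns 2 and 3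
   to these. *)
pose s c' := 2 <= r c'.
exists k.+1, M, (relabel s); split; [exact: glued_valid H| | exact: glued_genus H | |
  exact: relabel_equiv].
- apply: (@glued_knot _ _ _ _ (fun p => exists d, p = port d) H).
    move=> p; have := code_cports p; case: (code p) (codeK p) => j i pE.
    rewrite mem_cports => /andP[jk i4]; rewrite -[k.+1]Ts in jk.
    have [] := cv j i jk i4 _ _ FA
      (fun z z' => connect (mrel M) (uncode k z) (uncode k z')).
    + by move=> z z'; rewrite sym.
    + by move=> z z' z''; apply: connect_trans.
    + move=> [q q']; rewrite Ts => q1 q2; have := connect_through (uncode k (q, q')) H.
      by rewrite uncodeK // mem_cports q1 q2.
    + move=> z z' zA; have [_ /(_ _ _ zA)[<- _]] := FA.
      have zp : z \in cports k.+1.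
        have [h _] := mem_unpair zA.
        by rewrite (perm_mem (closed_perm H)) /= !inE h !orbT.
      have := connect_adj (uncode k z) H; congr connect.
      by apply: (can_inj (@codeK k)); rewrite (adj_code _ H) !uncodeK //;
        case: (glued_partner H zp).
    by move=> z c1 [d _ zE]; exists (port d); [rewrite -pE /port -zE | exists d].
  move=> _ _ [d ->] [d' ->].
  (* Opposite slots of a crossing are joined by an arc of its tile. *)
  have cst z : connect (mrel M) (port z) (port (st z)).
    have := connect_through (port z) H; rewrite portK; congr connect.
    rewrite /port -[st z]/(slot z 2) prt_slot /uncode /=; congr (_, inord _).
    have [_ _ ->] := Tc z.1 (in_setT _).
    rewrite -(modnDml (z.2 + r z.1)).
    have : (z.2 + r z.1) %% 4 < 4 by rewrite ltn_pmod.
    by case: ((z.2 + r z.1) %% 4) => [|[|[|[|//]]]] _; case: (odd _).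
  have cf z z' : fconnect (fun w => st (al w)) z z' -> connect (mrel M) (port z) (port z').
    move=> /iter_findex <-; elim: (findex _ _ _) => //= i IH.
    apply: connect_trans IH _; have [_ h] := tr (iter i (fun w => st (al w)) z).
    exact: connect_trans h (cst _).
  (* The strand reaches [d'] from [d] or from the other end of its edge, and [tr] connects these
     two. *)
  case: (cov d d') => /cf // h; have [_ h'] := tr d; exact: connect_trans h' h.
have tileE c' : mtile M (ord0, inord (e c')) = 9 + odd (r c') :> nat.
  have [_ ->] := glued_tile (inord (e c')) H; rewrite inordK //.
  by have [] := Tc c' (in_setT _).
have portE (d : dart D0) : ((ord0, inord (e d.1)),
    slot_side (mtile M (ord0, inord (e d.1))) d.2) = port (halfturn s d).
  rewrite /port /uncode /prt /=; congr pair; apply: val_inj.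
  rewrite /slot_side tileE /= inordK ?ltn_pmod // val_sh.
  have [_ r4 _] := Tc d.1 (in_setT _); have := ltn_ord d.2; rewrite /s.
  by case: (r d.1) r4 => [|[|[|[|//]]]] _ /= d4; rewrite ?val_sh /=; lia.
exists (fun c' => (ord0, inord (e c'))); split.
- move=> c1 c2 [/(congr1 val)]; rewrite /= !inordK // => h.
  by apply: Ti; rewrite ?in_setT.
- by move=> c'; rewrite /is_cross tileE; case: (odd _).
- move=> [i j]; have [_ _ ->] := glued_conn (i, j, ord0) H => cj.
  have [c' _ cE] := Tj j (ltn_ord j) cj; exists c'.
  by rewrite cE inord_val (ord1 i).
move=> d; rewrite [LHS](_ : _ = mtrace M (port (halfturn s d))); last first.
  by congr (mtrace M _); apply: portE.
have [-> _] := tr (halfturn s d); rewrite portE; congr port.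
by rewrite alE -[LHS]relabel_lnk.
Qed.
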